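(* For integers $t$ and $s\ge 3$, let $\mathrm{PR}_t(s)$ be the smallest integer $n\ge s$ such that in any $t$-coloring of the edges of $K_n$ there exists an $s$-cycle whose edges do not contain all $t$ colors. If $t\ge 3$, then $$\mathrm{PR}_t(s)=\begin{cases} s, & \text{if } 3<s\le 3\cdot 2^{t-3},\\ s+1, & \text{if } s\in[3\cdot 2^{t-3}+1,\;5\cdot 2^{t-2}-2],\\ s+2, & \text{if } s\in[5\cdot 2^{t-2}-1,\;5\cdot 2^{t-1}-4],\\ s+\mathrm{Round}\!\left(\frac{s-2}{2^t-2}\right), & \text{if } s\ge 5\cdot 2^{t-1}-3.\end{cases}$$
   Context: $K_n$ is the complete graph on $n$ vertices; an $s$-cycle is a cycle of length $s$. A $t$-coloring is an edge-coloring with $t$ colors. $\mathrm{Round}\left(\frac{s-2}{2^t-2}\right)$ is the closest integer to $\frac{s-2}{2^t-2}$, rounding up if it is $\frac12$ more than an integer. *)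

(* Defs.v *)
From mathcomp Require Import all_boot all_order all_algebra.

Set Implicit Arguments.
Unset Strict Implicit.
Unset Printing Implicit Defensive.

Import Order.TTheory GRing.Theory Num.Theory.

(* Adjacency in K_n. *)
Definition complete_graph (n : nat) : rel 'I_n := [rel x y | x != y].

(* The edge set of the cycle listed by [p]; the edge xy is the pair {x, y}. *)
Definition cycle_edges (n : nat) (p : seq 'I_n) : {set {set 'I_n}} :=
  [set [set x; next p x] | x in p].

(* A t-coloring is a map c from vertex sets to 'I_t; only its values on the
   edges, i.e. the 2-element sets, are ever used. *)
Definition forces_cycle (t s n : nat) : Prop :=
  forall c : {set 'I_n} -> 'I_t,
    exists p : seq 'I_n,
      [/\ size p = s, ucycle (complete_graph (n := n)) p
        & c @: cycle_edges p != [set: 'I_t]].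

(* [is_PR t s n] says that PR_t(s) exists and equals n. *)
Definition is_PR (t s n : nat) : Prop :=
  [/\ s <= n, forces_cycle t s n
    & forall m : nat, s <= m -> forces_cycle t s m -> n <= m].

Local Open Scope ring_scope.

(* The closest integer to x >= 0, ties being rounded up. *)
Definition round (x : rat) : nat :=
  let k := Num.truncn x in if x - k%:R < 1 / 2 then k else k.+1.

Lemma round_itv (x : rat) :
  0 <= x -> (round x)%:R - 1 / 2 <= x < (round x)%:R + 1 / 2.
Proof.
move=> x0; have /andP[lk ku] := truncn_itv x0; rewrite /round.
set k := Num.truncn x in lk ku *; rewrite -natr1 in ku.
case: ltP => hx; rewrite -?natr1; apply/andP; split.
- by apply: le_trans lk; rewrite gerBl.
- by rewrite addrC -ltrBlDr.
- by rewrite -addrA (_ : 1 - 1 / 2 = 1 / 2 :> rat) // addrC -lerBrDr.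
- by apply: lt_le_trans ku _; rewrite lerDl.
Qed.

(* Main.v *)
Require Import Defs.
From mathcomp Require Import all_boot all_order all_algebra zify ring lra.

Set Implicit Arguments.
Unset Strict Implicit.
Unset Printing Implicit Defensive.

(** Let G_i be the graph of the edges whose colour is not i. All s-cycles show
    all t colours exactly when no G_i has a cycle of length s; such colourings
    are called polychromatic below. With n = s + q vertices, s > 3 and
    4q <= s + 1, polychromatic colourings exist if and only if
    2 * threshold q (t - 1) < s, for a sequence of thresholds that essentially
    obeys M_0 = 0, M_1 = q + 1, M_(j+1) = 2 M_j + q (three colours and q = 0 are the
    one exception: there polychromatic colourings always exist). The four
    ranges of the theorem are what this condition gives for q = 0, 1, 2 and for
    q > 2.

    Existence ([polychromatic_construction]). Order the vertices and give the
    edge xy, x < y, the level of x, where level j is the interval from M_j to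
    M_(j+1), and the last level has no upper end. In G_j the vertices of level
    j are pairwise non-adjacent, and adjacent only to the M_j vertices before
    them. There are at least M_j + q of them, so a cycle that omits only q
    vertices would have to alternate between the two sets, and is too short
    as soon as 2 M_j < s ([blocking_set]). For q = 0 and q = 1 the first few
    vertices admit a tighter, cyclic pattern, which lowers the thresholds.

    Non-existence ([polychromatic_bound]). In a polychromatic colouring no G_i
    has a cycle of length s + 1 either ([no_cycle_succ]). Suppose that giving
    the edge uv of colour j another colour destroys polychromaticity. Then G_j
    has a path on s vertices from u to v, and, as in the proof of Ore's
    theorem, rotating this path shows that u and v together have many edges of
    colour j ([ore_bound]). Now recolour so as to make a monochromatic degree
    as large as possible. The vertices that attain the maximum form a layer:
    the edges from each of them to the remaining vertices have one main colour,
    and inside the layer the exceptions are tightly controlled. Repeating this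
    on the remaining vertices shows that one may assume the colouring to be
    almost one of the ordered colourings above ([exists_layered]), except that a balanced
    remainder could be left over, in which all vertices see two colours equally
    often; a degree count excludes it ([no_small_balanced]).

    In a layered colouring Chvatal's theorem, applied to G_i with q vertices
    removed, provides for every colour i a layer such that the vertices of main
    colour i up to it outnumber those of other main colours before it by at
    least q ([level_or_small]). Ordering the colours by these layers, each colour
    has to take at least as many vertices as all the earlier ones together, plus
    q, so the totals double plus q at each step ([growth]); only for the first
    layer, with two or three colours in it, is there something to gain, and
    this accounts exactly for the small cases. *)

(** * Cycles one vertex longer *)

Section Walks.
Variables (T : eqType) (e : rel T).
Hypothesis eC : symmetric e.

(** The rotation behind the theorems of Ore and Posa: follow the path up to
    [y], jump to its end, and come back to the successor of [y]. *)
Lemma rotation x p y :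
    path e x p -> uniq (x :: p) -> y \in x :: p -> y != last x p ->
    e x (next (x :: p) y) -> e y (last x p) ->
  exists2 p', perm_eq p' (x :: p) & cycle e p'.
Proof.
move=> ep Up yp; case/splitPr Dp: _ / yp => [p1 p2].
case: p2 Dp => [|z p2] Dp.
  have -> : last x p = last x (x :: p) by [].
  by rewrite Dp last_cat /= eqxx.
have zE : next (x :: p) y = z.
  rewrite Dp next_nth mem_cat mem_head orbT.
  have : uniq (p1 ++ y :: z :: p2) by rewrite -Dp.
  rewrite cat_uniq => /and3P[_ /norP[yNp1 _] _].
  rewrite index_cat (negbTE yNp1) /= eqxx addn0.
  by case: (p1) => [|w p3] //=; rewrite nth_cat ltnNge leqnSn /= subSnn.
have lE : last x p = last z p2.
  have -> : last x p = last x (x :: p) by [].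
  by rewrite Dp last_cat.
rewrite -Dp zE lE => _ exz eyl.
have lrev : last (last z p2) (rev (belast z p2)) = z.
  by case: (p2) => //= a q; rewrite rev_cons last_rcons.
have : path e z p2 /\ exists q1, rcons p1 y = x :: q1 /\ path e x q1.
  case: p1 Dp => [|w p1] /= [xw Dp]; rewrite -xw in zE lE lrev *.
    by move: ep; rewrite Dp /= => /andP[_ ->]; split => //; exists [::].
  move: ep; rewrite Dp cat_path /= => /and4P[h1 h2 _ ->]; split => //.
  by exists (rcons p1 y); rewrite rcons_path h1.
case=> ezp2 [q1 [q1E eq1]].
have q1l : last x q1 = y.
  by have := congr1 (last x) q1E; rewrite last_rcons.
exists (x :: q1 ++ last z p2 :: rev (belast z p2)).
  rewrite Dp -!cat_cons -q1E -cats1 -catA perm_cat2l /= perm_cons.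
  by rewrite -rev_rcons -lastI perm_rev.
rewrite /= rcons_cat cat_path eq1 /= q1l eyl rcons_path lrev eC exz andbT.
by rewrite rev_path (eq_path (e' := e)) // => a b; rewrite eC.
Qed.

End Walks.

Section Colorings.
Variables (V C : finType).
Implicit Types (c : {ffun {set V} -> C}) (i j : C) (x y : V).

Definition avoid c i : rel V := [rel x y | (x != y) && (c [set x; y] != i)].

(** A boolean on finite functions, so that extremal polychromatic colourings
    can be picked. *)
Definition polychromatic s c :=
  [forall i, forall p : s.-tuple V, uniq p ==> ~~ cycle (avoid c i) p].

Lemma avoidC c i : symmetric (avoid c i).
Proof. by move=> x y; rewrite /avoid /= eq_sym setUC. Qed.

Lemma polychromaticP s c : reflect
  (forall i p, size p = s -> uniq p -> ~~ cycle (avoid c i) p)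
  (polychromatic s c).
Proof.
apply: (iffP forallP) => [cP i p sp Up | cP i].
  by have /eqP sp' := sp; have /forallP/(_ (Tuple sp'))/implyP := cP i; apply.
by apply/forallP => p; apply/implyP/cP; rewrite size_tuple.
Qed.

(** In this section [f] runs periodically around a cycle of length [L = s.+1] in
    the graph that avoids [i]; the existence of such a cycle is refuted by
    exhibiting cycles of length [s] that avoid some colour. *)
Section NextLength.
Variables (c : {ffun {set V} -> C}) (s : nat).
Hypotheses (cP : polychromatic s c) (C3 : 2 < #|C|) (s4 : 3 < s).

Let no_short_cycle j (g : nat -> V) :
    (forall a b, a < b < s -> g a <> g b) ->
    (forall a, a.+1 < s -> avoid c j (g a) (g a.+1)) ->
    avoid c j (g s.-1) (g 0) -> False.
Proof.
move=> gI ge g0; have /polychromaticP/(_ j (mkseq g s)) cP' := cP.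
apply: (negP (cP' (size_mkseq _ _) _)).
  apply/mkseq_uniqP => a b; rewrite !inE => ha hb gab.
  case: (ltngtP a b) => // h; first by case: (gI a b); rewrite ?h.
  by case: (gI b a); rewrite ?h.
case: s s4 ge g0 => // s' _ ge g0.
rewrite (cycle_path (g 0)) /mkseq.
have -> : last (g 0) [seq g a | a <- iota 0 s'.+1] = g s'.
  by rewrite -nth_last size_map size_iota (nth_map 0) ?size_iota // nth_iota.
apply/(pathP (g 0)) => a; rewrite size_map size_iota => ha.
rewrite (nth_map 0) ?size_iota // nth_iota // add0n.
case: a ha => [//|a] ha; rewrite -[nth _ (_ :: _) _]/(nth (g 0) _ a).
by rewrite (nth_map 0) ?size_iota ?(ltnW ha) // nth_iota ?(ltnW ha) //; apply: ge.
Qed.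

Variables (i : C) (f : nat -> V).
Variable L : nat.
Hypothesis Ls : L = s.+1.
Hypothesis fL : forall a, f (a + L) = f a.
Hypothesis fI : forall a b, f a = f b -> a = b %[mod L].
Hypothesis fe : forall a, avoid c i (f a) (f a.+1).

Let col a b := c [set f a; f b].

Let colC a b : col a b = col b a. Proof. by rewrite /col setUC. Qed.

Let fI2 a b : f a = f b -> a < b + L.*2 -> b < a + L.*2 ->
  [\/ a = b, a = b + L | b = a + L].
Proof.
move=> /fI h; have E1 := divn_eq a L; have E2 := divn_eq b L.
have E3 : a %% L < L by rewrite ltn_pmod // Ls.
rewrite -h in E2.
move: (a %/ L) (b %/ L) (a %% L) E1 E2 E3 => u v r -> -> hr h1 h2.
case: (ltngtP u v) => [huv|huv|->]; last by apply: Or31.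
- have : v < u.+2.
    rewrite ltnNge; apply/negP => h3.
    have : u.+2 * L <= v * L by rewrite leq_mul2r h3 orbT.
    lia.
  move=> h3; have -> : v = u.+1 by lia.
  by apply: Or33; rewrite mulSn; lia.
- have : u < v.+2.
    rewrite ltnNge; apply/negP => h3.
    have : v.+2 * L <= u * L by rewrite leq_mul2r h3 orbT.
    lia.
  move=> h3; have -> : u = v.+1 by lia.
  by apply: Or32; rewrite mulSn; lia.
Qed.

Let fN a b : a < b < a + L -> f a <> f b.
Proof. by move=> h /fI2; case; lia. Qed.

Let avE j a b : a < b < a + L -> col a b != j -> avoid c j (f a) (f b).
Proof. by move=> h; rewrite /avoid /= => ->; rewrite andbT; apply/eqP/fN. Qed.

(** Replacing two consecutive edges by their chord gives a cycle of length [s],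
    so that all these chords have colour [i], and all of them may be used in
    the cycles avoiding another colour. *)
Let chord a : col a a.+2 = i.
Proof.
apply/eqP; apply/negPn/negP => h.
apply: (@no_short_cycle i (fun k => f (a.+2 + k))) => [k l kl | k ks |].
- by apply: fN; lia.
- by rewrite addnS.
- rewrite (_ : a.+2 + s.-1 = a + L) ?fL; last by lia.
  by rewrite addn0; apply: avE; rewrite //; lia.
Qed.

Let chordj j a : j != i -> avoid c j (f a) (f a.+2).
Proof. by move=> ji; apply: avE; rewrite ?chord 1?eq_sym //; lia. Qed.

Let others : exists j1 j2, [/\ j1 != i, j2 != i & j1 != j2].
Proof.
have : 1 < #|[set~ i]| by rewrite cardsC1; lia.
case/card_gt1P => j1 [j2 []]; rewrite !inE => h1 h2 h3.
by exists j1, j2.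
Qed.

(** For odd [L] the chords form one cycle through all vertices. Leaving out the
    vertex 2 costs one further edge, from 0 to 4, and its colour differs from
    one of two colours other than [i]. *)
Lemma no_odd_cycle : odd L -> False.
Proof.
move=> Lodd; have [j1 [j2 [h1 h2 h12]]] := others.
have [j [ji h]] : exists j, j != i /\ col 0 4 != j.
  by case: (eqVneq (col 0 4) j1) => [->|h]; [exists j2 | exists j1].
apply: (@no_short_cycle j (fun k => f (4 + k.*2))) => [k l kl /fI2 | k ks |].
- by case; lia.
- by rewrite doubleS !addnS; apply: chordj.
- rewrite (_ : 4 + s.-1.*2 = 0 + L + L) ?fL; last by lia.
  by apply: avE; rewrite //; lia.
Qed.

(** For even [L] the chords form two cycles, on the even and on the odd
    positions, which have to be joined by two cross edges. *)
Section Even.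
Variable l : nat.
Hypothesis Ll : L = l.*2.

Let f_parity a b : f a = f b -> odd a = odd b.
Proof.
move=> /fI h; rewrite (divn_eq a L) (divn_eq b L) h !oddD !oddM Ll odd_double.
by rewrite !andbF.
Qed.

Let avX j a b : odd a != odd b -> col a b != j -> avoid c j (f a) (f b).
Proof.
move=> h; rewrite /avoid /= => ->; rewrite andbT; apply/eqP => /f_parity E.
by rewrite E eqxx in h.
Qed.

(** The candidate cycle visits the even positions except 4, bridged by the
    chord from 2 to 6, and then all the odd ones. *)
Let detour j (b : nat) : j != i -> odd b ->
  col 2 6 != j -> col 0 b != j -> col 2 b.+2 != j -> False.
Proof.
move=> ji ob chj h0 hb.
apply: (@no_short_cycle j (fun k => if k == 0 then f 2 else if k < l.-1 then f (4 + k.*2)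
                  else f (b.+2 + (s.-1 - k).*2))) => [u v uv | a ha |].
- have -> : (v == 0) = false by apply/eqP; lia.
  case: (eqVneq u 0) => u0.
    case: ifP => vl; first by apply: fN; lia.
    by move=> /f_parity; lia.
  case: ifP => ul; case: ifP => vl; last 1 first.
  + by move=> /esym; apply: fN; lia.
  + by apply: fN; lia.
  + by move=> /f_parity; lia.
  + lia.
- rewrite -[a.+1 == 0]/false; case: (eqVneq a 0) => [->|a0].
    have -> : 1 < l.-1 by lia.
    by apply: avE => //; lia.
  case: (ltngtP a.+1 l.-1) => al.
  + by rewrite doubleS !addnS; apply: chordj.
  + rewrite avoidC (_ : (s.-1 - a).*2 = (s.-1 - a.+1).*2.+2); last by lia.
    by rewrite !addnS; apply: chordj.
  + rewrite (_ : 4 + a.*2 = 0 + L) ?fL; last by lia.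
    rewrite (_ : b.+2 + _ = b + L) ?fL; last by lia.
    by apply: avX; rewrite //= ob.
- rewrite ifF; last by lia.
  rewrite ifF; last by lia.
  by rewrite subnn addn0 eqxx avoidC; apply: avX; rewrite //= ob.
Qed.

(** Both cycles of chords, the second one without [y.+2], would be joined by the
    two cross edges named here. As this holds for all [j] other than [i], the
    two edges carry two given such colours, one each. *)
Let knight1 j (x y : nat) : j != i -> odd x != odd y ->
  (col x y == j) || (col x.+2 (y + 4) == j).
Proof.
move=> ji xy; apply/negPn/negP; rewrite negb_or => /andP[h1 h2].
apply: (@no_short_cycle j (fun k => if k < l then f (x.+2 + k.*2)
                  else f (y + 4 + (s.-1 - k).*2))) => [a b ab | a ha |].
- case: ifP => al; case: ifP => bl; last 1 first.
  + by move=> /esym; apply: fN; lia.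
  + by apply: fN; lia.
  + by move=> /f_parity; lia.
  + lia.
- case: (ltngtP a.+1 l) => al.
  + by rewrite doubleS !addnS; apply: chordj.
  + rewrite avoidC (_ : (s.-1 - a).*2 = (s.-1 - a.+1).*2.+2); last by lia.
    by rewrite !addnS; apply: chordj.
  + rewrite (_ : x.+2 + a.*2 = x + L) ?fL; last by lia.
    rewrite (_ : y + 4 + _ = y + L) ?fL; last by lia.
    exact: avX.
- rewrite ifF; last by lia.
  rewrite ifT; last by lia.
  rewrite subnn !addn0 avoidC; apply: avX => //; lia.
Qed.

(** The same two paths, with the second one traversed in the other direction. *)
Let knight2 j (x y : nat) : j != i -> odd x != odd y ->
  (col x (y + 4) == j) || (col x.+2 y == j).
Proof.
move=> ji xy; apply/negPn/negP; rewrite negb_or => /andP[h1 h2].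
apply: (@no_short_cycle j (fun k => if k < l then f (x.+2 + k.*2)
                  else f (y + 4 + (k - l).*2))) => [a b ab | a ha |].
- case: ifP => al; case: ifP => bl; last 1 first.
  + by apply: fN; lia.
  + by apply: fN; lia.
  + by move=> /f_parity; lia.
  + lia.
- case: (ltngtP a.+1 l) => al.
  + by rewrite doubleS !addnS; apply: chordj.
  + rewrite (_ : (a.+1 - l).*2 = (a - l).*2.+2); last by lia.
    by rewrite !addnS; apply: chordj.
  + rewrite (_ : x.+2 + a.*2 = x + L) ?fL; last by lia.
    rewrite al subnn addn0; apply: avX => //; lia.
- rewrite ifF; last by lia.
  rewrite ifT; last by lia.
  rewrite (_ : y + 4 + _ = y + L) ?fL; last by lia.
  rewrite addn0 avoidC; apply: avX => //; lia.
Qed.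

(** Moving from one cross edge to another along [knight1] and [knight2] exchanges
    the colours [j1] and [j2], which determines enough of the cross edges to
    find a [detour]. *)
Lemma no_even_cycle : False.
Proof.
have [j1 [j2 [h1 h2 h12]]] := others.
(* Of two edges, one of which has colour [j1] and one colour [j2], each one
   determines the other. *)
have flip a b : (a == j1) || (b == j1) -> (a == j2) || (b == j2) ->
    (b == j1) = (a != j1) /\ (a == j2) = (a != j1).
  have [-> _|_ /= /eqP->] := eqVneq a j1; last by rewrite (negbTE h12) orbF eqxx.
  by rewrite (negbTE h12) => /= /eqP ->; rewrite eq_sym (negbTE h12).
have k1 (x y : nat) xy := flip _ _ (@knight1 _ x y h1 xy) (@knight1 _ x y h2 xy).
have k2 (x y : nat) xy := flip _ _ (@knight2 _ x y h1 xy) (@knight2 _ x y h2 xy).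
have bishop (y : nat) : odd y -> (col 2 (y + 4) == j1) = (col 0 y.+2 == j1).
  move=> oy.
  have [E1 _] := k2 2 y ltac:(by rewrite /= oy).
  have [E2 _] := k2 y 0 ltac:(by rewrite /= oy).
  move: E1 E2; rewrite add0n [col 4 y]colC [col y.+2 0]colC => -> ->.
  by rewrite negbK.
have rook : (col 0 5 == j1) = (col 0 3 != j1).
  have [E1 _] := k1 3 0 isT; have [E2 _] := k2 2 5 isT.
  have [E3 _] := k1 0 5 isT.
  move: E1 E2 E3; rewrite add0n [col 5 4]colC [col 3 0]colC => -> -> ->.
  by rewrite negbK.
have [j [b [ji chj ob h0 hb]]] : exists j b,
    [/\ j != i, col 2 6 != j, odd b, col 0 b != j & col 2 b.+2 != j].
  have [_ e3] := k1 0 3 isT; have [_ e5] := k1 0 5 isT.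
  have [_ e3'] := k1 2 5 isT; have [_ e5'] := k1 2 7 isT.
  have E1 := bishop 1 isT; have E2 := bishop 3 isT.
  rewrite -![_ + 4]/(_.+4) in E1 E2.
  case: (eqVneq (col 2 6) j1) => [->|hj]; [exists j2 | exists j1].
    case: (boolP (col 0 3 == j1)) => c3; [exists 3 | exists 5].
      by rewrite h2 h12 e3 e3' E1 c3.
    by rewrite h2 h12 e5 e5' E2 rook c3.
  case: (boolP (col 0 3 == j1)) => c3; [exists 5 | exists 3].
    by rewrite h1 hj E2 rook c3.
  by rewrite h1 hj E1 c3.
exact: (detour ji ob chj h0 hb).
Qed.

End Even.
End NextLength.

(** This turns every near miss into a contradiction later on: a path on [s]
    vertices avoiding [i] can be closed neither directly nor through one
    additional vertex. *)
Lemma no_cycle_succ s c i p : polychromatic s c -> 2 < #|C| -> 3 < s ->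
  size p = s.+1 -> uniq p -> ~~ cycle (avoid c i) p.
Proof.
move=> cP C3 s4 sp Up; apply/negP => pc.
have [x0 _] : exists x0, x0 \in p by case: (p) sp => // x q _; exists x; rewrite mem_head.
pose f a := nth x0 p (a %% s.+1).
have fL a : f (a + s.+1) = f a by rewrite /f modnDr.
have fI a b : f a = f b -> a = b %[mod s.+1].
  by move/eqP; rewrite nth_uniq ?sp ?ltn_pmod // => /eqP.
have fe a : avoid c i (f a) (f a.+1).
  have ha : a %% s.+1 < s.+1 by rewrite ltn_pmod.
  have := next_cycle pc (_ : f a \in p); rewrite mem_nth ?sp // => /(_ isT).
  rewrite next_nth mem_nth ?sp // /f; case: p sp Up {pc f fL fI} => // y q [sq] Uq.
  rewrite index_uniq //= ?sq // -(addn1 a) -modnDml addn1.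
  case: (ltngtP (a %% s.+1) s) => [h|h|->]; last 1 first.
  - by rewrite modnn [nth y q s]nth_default ?sq.
  - by rewrite [_.+1 %% _]modn_small //= [nth y q _](set_nth_default x0) ?sq.
  - lia.
have := odd_double_half s.+1; case: (boolP (odd s.+1)) => Lo E.
  exact: (no_odd_cycle cP C3 s4 (erefl _) fL fI fe Lo).
exact: (no_even_cycle cP C3 s4 (erefl _) fL fI fe (esym E)).
Qed.

End Colorings.

(** * Essential edges and an Ore-type inequality *)

Section PathNext.
Variables (T : eqType) (e : rel T).

Lemma path_next x p y :
  path e x p -> y \in x :: p -> y != last x p -> e y (next (x :: p) y).
Proof.
move=> ep yp yl; pose e' a b := (a != last x p) ==> e a b.
suff /next_cycle/(_ yp) : cycle e' (x :: p) by rewrite /e' yl.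
rewrite /= rcons_path {2}/e' eqxx /= andbT.
by apply: sub_path ep => a b; rewrite /e' => ->; rewrite implybT.
Qed.

Lemma next_last (x : T) p : uniq (x :: p) -> next (x :: p) (last x p) = x.
Proof.
by move=> U; rewrite next_nth mem_last index_last // nth_default.
Qed.

End PathNext.

Lemma set2_eq (T : finType) (x y z w : T) :
  [set x; y] = [set z; w] -> (x = z /\ y = w) \/ (x = w /\ y = z).
Proof.
move=> E; have /set2P[xz|xw] : x \in [set z; w] by rewrite -E set21.
  have : w \in [set x; y] by rewrite E set22.
  have : y \in [set z; w] by rewrite -E set22.
  by rewrite !inE -xz => /orP[] /eqP -> /orP[] /eqP; [left | left | left | left].
have : z \in [set x; y] by rewrite E set21.
have : y \in [set z; w] by rewrite -E set22.
by rewrite !inE -xw => /orP[] /eqP -> /orP[] /eqP; right.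
Qed.

(** A cycle that exists only thanks to the edge from [x] to [u] uses it, hence
    is a path once this edge is dropped. *)
Lemma cycle_edge_path (T : finType) (e e' : rel T) p x u :
    symmetric e ->
    (forall a b, e' a b -> [set a; b] != [set x; u] -> e a b) ->
    2 < size p -> uniq p -> cycle e' p -> ~~ cycle e p ->
  exists q, [/\ path e u q, last u q = x & perm_eq (u :: q) p].
Proof.
move=> eC keep p3 Up pc npc.
have [y yp ny] : exists2 y, y \in p & ~~ e y (next p y).
  apply/hasP; rewrite has_predC; apply/negP => /allP h.
  by case/negP: npc; apply: cycle_from_next.
have E : [set y; next p y] = [set x; u].
  by apply/eqP/negPn/negP => /(keep _ _ (next_cycle pc yp)) h; rewrite h in ny.
have [n [q pE]] : exists n q, rot n p = next p y :: q.
  have := mem_next p y; rewrite yp => h; case: (rot_to h) => n q; by exists n, q.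
set z := next p y in E pE; clear ny.
have Uq : uniq (z :: q) by rewrite -pE rot_uniq.
have qq : perm_eq (z :: q) p by rewrite -pE perm_rot.
have qc : cycle e' (z :: q) by rewrite -pE rot_cycle.
have lq : last z q = y.
  apply: (can_inj (prev_next Up)); rewrite -(next_rot n Up) pE.
  by rewrite (next_last Uq).
rewrite -(perm_size qq) in p3.
have qp : path e z q.
  move: qc; rewrite /= rcons_path => /andP[qc _].
  case: q Uq p3 lq qc {pE qq} => [|b q] /= Uq p3 lq; first by [].
  case/andP=> zb bq; apply/andP; split.
    apply: keep zb _; apply/eqP; rewrite -E setUC => /set2_eq[] [h1 h2].
      have := lq; rewrite -h1 => bl; case: (q) p3 Uq bl => [|w q'] //= _.
      by move=> /and3P[_ b_q _] bl; case/negP: b_q; rewrite -{1}bl mem_last.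
    by move: Uq; rewrite h1 inE eqxx.
  move: bq; apply: (sub_in_path (P := [pred w | w != z])) => [a a'|].
    rewrite !inE => az a'z /keep; apply; rewrite -E; apply/eqP => h.
    have : z \in [set a; a'] by rewrite h set22.
    by rewrite !inE ![z == _]eq_sym (negbTE az) (negbTE a'z).
  case/andP: Uq => zq _; apply/allP => w wq; rewrite inE.
  by apply: contraNneq zq => <-.
have [[yx zu] | [yu zx]] := set2_eq E.
  by exists q; rewrite -zu lq.
have RE : last z q :: rev (belast z q) = rev (z :: q).
  by rewrite -rev_rcons -lastI.
exists (rev (belast z q)); rewrite -yu -lq; split.
- by rewrite rev_path (eq_path (e' := e)) // => a b; rewrite eC.
- by case: (q) zx => [|b q'] //= zx; rewrite rev_cons last_rcons.
- by rewrite RE perm_rev.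
Qed.

Section Recoloring.
Variables (V C : finType) (s : nat).
Implicit Types (c : {ffun {set V} -> C}) (i j : C) (x y u v : V) (X Y : {set V}).

Definition recolor c x u i : {ffun {set V} -> C} :=
  [ffun e => if e == [set x; u] then i else c e].

(** Recolouring the edge adds it to one graph only, the one that avoids its old
    colour, so the cycle that appears goes through this edge. *)
Lemma essential_path c x u i : polychromatic s c -> 2 < s ->
    c [set x; u] != i -> ~~ polychromatic s (recolor c x u i) ->
  exists p, [/\ path (avoid c (c [set x; u])) u p, last u p = x,
                uniq (u :: p) & size (u :: p) = s].
Proof.
move=> /polychromaticP cP s3 ij; set j := c [set x; u] in ij *.
have keep k a b : avoid (recolor c x u i) k a b -> [set a; b] != [set x; u] -> avoid c k a b.
  by rewrite /avoid /= ffunE => h /negbTE n; rewrite n in h.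
rewrite /polychromatic negb_forall => /existsP[k].
rewrite negb_forall => /existsP[[p /= sp]]; rewrite negb_imply negbK => /andP[Up pc].
move/eqP: sp => sp; case: (eqVneq k j) pc => [-> pc | kj pc]; last first.
  case/negP: (cP k p sp Up); apply: sub_cycle pc => a b ab.
  case: (eqVneq [set a; b] [set x; u]) => [E | ne]; last exact: keep ab ne.
  by move: ab; rewrite /avoid /= E => /andP[-> _] /=; rewrite eq_sym.
have p3 : 2 < size p by rewrite sp.
have [q [h1 h2 h3]] :=
  cycle_edge_path (@avoidC _ _ c j) (@keep j) p3 Up pc (cP j p sp Up).
have Uq : uniq (u :: q) by rewrite (perm_uniq h3).
have sq : size (u :: q) = s by rewrite (perm_size h3).
by exists q.
Qed.

Definition mono c Y j x := #|[set y in Y | (y != x) && (c [set x; y] == j)]|.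

Lemma mono_split c Y j x : x \in Y ->
  #|[set y in Y | avoid c j x y]| + mono c Y j x = #|Y|.-1.
Proof.
move=> xY; rewrite (cardsD1 x Y) xY /= /mono -cardsUI.
rewrite [_ :&: _](_ : _ = set0) ?cards0 ?addn0; last first.
  apply/setP => y; rewrite !inE eq_sym /avoid /=.
  by case: (y \in Y); case: (x == y); case: (c _ == j).
rewrite add0n; apply: eq_card => y; rewrite !inE /avoid /= [x == y]eq_sym.
by case: (y \in Y); case: (y == x); case: (c _ == j).
Qed.

(** Every [y] joined to [v] by an edge avoiding [j] is sent to its successor on
    the path, or to itself if it is not on the path. The edge from [u] to the
    image has colour [j]: otherwise [rotation] yields a cycle of length [s], or
    [y] closes the path to a cycle of length [s.+1]. The set [X] of vertices
    whose edges to the complement are monochromatic is there because the bound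
    is needed for the degrees within the complement; an image in [X] would
    have the main colour [j], and so could not be the successor of [y]. *)
Lemma ore_bound c X (mn : V -> C) u v p :
    polychromatic s c -> 2 < #|C| -> 3 < s ->
    {in X & ~: X, forall x y, c [set x; y] = mn x} ->
    u \notin X -> v \notin X -> u != v ->
    path (avoid c (c [set v; u])) u p -> last u p = v ->
    uniq (u :: p) -> size (u :: p) = s ->
  #|~: X|.-1 <= mono c (~: X) (c [set v; u]) u + mono c (~: X) (c [set v; u]) v.
Proof.
move=> cP C3 s4 Xmn uX vX uv; set j := c [set v; u] => up lp Up sp.
have cP' := polychromaticP _ _ cP.
rewrite -(mono_split c j (_ : v \in ~: X)) ?inE // leq_add2r.
set N := [set y in _ | _].
pose f y := if y \in u :: p then next (u :: p) y else y.
have fI : {in N &, injective f}.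
  move=> y z _ _; rewrite /f; case: ifP => yp; case: ifP => zp //.
  - exact: (can_inj (prev_next Up)).
  - by move=> E; rewrite -E mem_next yp in zp.
  - by move=> E; rewrite E mem_next zp in yp.
rewrite -(card_in_imset fI); apply/subset_leq_card/subsetP => _ /imsetP[y yN ->].
move: yN; rewrite !inE => /andP[yX vy]; rewrite /f; case: ifP => yp; last first.
  have uy : y != u by apply: contraFneq yp => ->; rewrite mem_head.
  rewrite yX uy /=; apply/negPn/negP => h.
  have sp' : size (y :: u :: p) = s.+1 by rewrite -sp.
  apply: (negP (no_cycle_succ j cP C3 s4 sp' _)); first by rewrite cons_uniq yp Up.
  rewrite /= rcons_path lp up vy !andbT avoidC /avoid /= eq_sym uy.
  by move: h; rewrite eq_sym.
have yv : y != last u p by rewrite lp; case/andP: vy; rewrite eq_sym.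
have yz := path_next up yp yv; set z := next (u :: p) y in yz *.
have zu : z != u.
  by apply: contraNneq yv => zu; apply/eqP/(can_inj (prev_next Up)); rewrite next_last.
have uz : c [set u; z] == j.
  apply/negPn/negP => h.
  have uz : avoid c j u z by rewrite /avoid /= eq_sym zu.
  have yl : avoid c j y (last u p) by rewrite lp avoidC.
  have [q pq qc] := rotation (@avoidC _ _ c j) up Up yp yv uz yl.
  apply: (negP (cP' j q _ _) qc); first by rewrite (perm_size pq).
  by rewrite (perm_uniq pq).
rewrite zu uz !andbT; apply/negP => zX.
have : avoid c j y z by []; rewrite /avoid /= setUC.
rewrite (Xmn z y) ?inE // -(Xmn z u) ?inE // setUC.
by rewrite (eqP uz) eqxx andbF.
Qed.

End Recoloring.

(** * Peeling the vertices into layers *)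

Section Layers.
Variables (V C : finType) (s : nat).
Implicit Types (c : {ffun {set V} -> C}) (i j : C) (x y u v : V) (X Y : {set V}).

Lemma mono_add c Y i j x : x \in Y -> i != j ->
  mono c Y i x + mono c Y j x <= #|Y|.-1.
Proof.
move=> xY ij; rewrite -(mono_split c j xY) leq_add2r.
apply/subset_leq_card/subsetP => y; rewrite !inE /avoid /= eq_sym.
by case/and3P=> -> -> /eqP ->.
Qed.

(** What is left of the maximality of the monochromatic degree [d] within [Y]:
    an edge of another colour at a vertex attaining [d] is extremal at its other
    end too, and its colour and the dominant one are the only ones at [x]. *)
Definition saturated c Y d := forall x i u, x \in Y -> u \in Y ->
  mono c Y i x = d -> u != x -> c [set x; u] != i ->
  mono c Y (c [set x; u]) u = d /\ d + mono c Y (c [set x; u]) x = #|Y|.-1.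

(** Among all polychromatic colourings that differ from [c] only on edges inside
    [~: X], choose one that contains a vertex of the largest monochromatic
    degree. Giving an edge at this vertex the dominant colour would increase
    the degree, so it destroys polychromaticity, and [ore_bound] holds with
    equality. *)
Lemma exists_saturated c X (mn : V -> C) :
    polychromatic s c -> 2 < #|C| -> 3 < s ->
    {in X & ~: X, forall x y, c [set x; y] = mn x} -> X != setT ->
  exists c' d, [/\ polychromatic s c',
    forall e : {set V}, ~~ (e \subset ~: X) -> c' e = c e,
    (forall x i, x \in ~: X -> mono c' (~: X) i x <= d) /\
    (exists x i, x \in ~: X /\ mono c' (~: X) i x = d)
    & saturated c' (~: X) d].
Proof.
move=> cP C3 s4 Xmn XT; set Y := ~: X.
have [y0 y0Y] : exists y, y \in Y.
  by apply/set0Pn; rewrite -(inj_eq (@setC_inj _)) setCK setC0.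
have [i0 _] : exists i : C, i \in C by apply/card_gt0P; apply: leq_trans C3.
pose P (z : {ffun {set V} -> C} * V * C) := [&& polychromatic s z.1.1,
  [forall e : {set V}, ~~ (e \subset Y) ==> (z.1.1 e == c e)] & z.1.2 \in Y].
pose F (z : {ffun {set V} -> C} * V * C) := mono z.1.1 Y z.2 z.1.2.
have P0 : P (c, y0, i0).
  by rewrite /P /= cP y0Y andbT; apply/forallP => e; rewrite eqxx implybT.
case: (arg_maxnP F P0) => -[[c' v] i'] /and3P[/= c'P /forallP c'E vY] max.
set d := F (c', v, i') in max.
have agree (e : {set V}) : ~~ (e \subset Y) -> c' e = c e.
  by move=> h; apply/eqP; apply: (implyP (c'E e)).
have Xmn' : {in X & ~: X, forall x y, c' [set x; y] = mn x}.
  move=> x y xX yX; rewrite agree; first exact: Xmn.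
  by apply/subsetPn; exists x; rewrite ?set21 // inE xX.
have bound c2 x i : polychromatic s c2 ->
    (forall e : {set V}, ~~ (e \subset Y) -> c2 e = c e) -> x \in Y -> mono c2 Y i x <= d.
  move=> h1 h2 h3; apply: (max (c2, x, i)); rewrite /P /= h1 h3 andbT.
  by apply/forallP => e; apply/implyP => /h2 ->.
exists c', d; split => //.
  by split=> [x i xY|]; [exact: bound | exists v, i'].
move=> x i u xY uY xd ux cxu.
have nP : ~~ polychromatic s (recolor c' x u i).
  apply/negP => h.
  suff lt : mono c' Y i x < mono (recolor c' x u i) Y i x.
    have := bound _ x i h _ xY; rewrite leqNgt -xd lt => /(_ _)/notF; apply.
    move=> e eY; rewrite ffunE; case: eqP => [E|_]; last exact: agree.
    by case/subsetP: eY => w; rewrite E => /set2P[] ->.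
  rewrite /mono.
  apply/proper_card/properP; split.
    apply/subsetP => w; rewrite !inE ffunE => /and3P[-> -> /eqP->].
    by rewrite if_same /=.
  by exists u; move: uY; rewrite !inE ?ffunE ?eqxx ux => -> //=; rewrite (negbTE cxu).
have [p [up lp Up sp]] := essential_path c'P (ltnW s4) cxu nP.
have uX : u \notin X by rewrite !inE in uY.
have xX : x \notin X by rewrite !inE in xY.
have arith a b e : a <= b + e -> b <= d -> d + e <= a -> b = d /\ d + e = a.
  by clear; lia.
have := ore_bound c'P C3 s4 Xmn' uX xX ux up lp Up sp.
rewrite -/Y; have h1 := bound c' u (c' [set x; u]) c'P agree uY.
have h2 : d + mono c' Y (c' [set x; u]) x <= #|Y|.-1.
  by rewrite -xd; apply: mono_add; rewrite // eq_sym.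
by move=> h0; apply: arith h0 h1 h2.
Qed.

Lemma saturated_pair c Y d v i : saturated c Y d -> d > 0 ->
    #|Y| = d.*2.+1 -> v \in Y -> mono c Y i v = d ->
  exists j, j != i /\ mono c Y j v = d.
Proof.
move=> sat d0 Yd vY vd; have := mono_split c i vY; rewrite vd Yd => h.
have /card_gt0P[u] : 0 < #|[set y in Y | avoid c i v y]| by lia.
rewrite inE => /and3P[uY vu cu]; rewrite eq_sym in vu.
have [_ E] := sat _ _ _ vY uY vd vu cu.
by exists (c [set v; u]); split => //; lia.
Qed.

(** The case in which peeling stops: no vertex of [Y] has a dominant colour, as
    each one divides its edges equally between two colours. *)
Definition balanced c Y d := [/\ #|Y| = d.*2.+1,
  forall x i, x \in Y -> mono c Y i x <= d &
  d > 0 -> forall x, x \in Y ->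
    exists i j, [/\ i != j, mono c Y i x = d & mono c Y j x = d]].

Lemma saturated_balanced c Y d v i : saturated c Y d -> 
    #|Y| = d.*2.+1 -> (forall x i, x \in Y -> mono c Y i x <= d) ->
    v \in Y -> mono c Y i v = d -> balanced c Y d.
Proof.
move=> sat Yd bd vY vd; split=> // d0 x xY.
have [k xk] : exists k, mono c Y k x = d.
  case: (eqVneq x v) => [->|xv]; first by exists i.
  case: (eqVneq (c [set v; x]) i) => [E|cx].
    have [j [ji vj]] := saturated_pair sat d0 Yd vY vd.
    have cj : c [set v; x] != j by rewrite E eq_sym.
    by have [h _] := sat _ _ _ vY xY vj xv cj; exists (c [set v; x]).
  by have [h _] := sat _ _ _ vY xY vd xv cx; exists (c [set v; x]).
have [j [jk xj]] := saturated_pair sat d0 Yd xY xk.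
by exists j, k.
Qed.

(** [b] numbers the layers of [X] and [mn] is the main colour, that of all edges
    to later layers and to the vertices outside [X]. Edges inside a layer may be
    exceptional for one end, but then have the main colour of the other end,
    and the number [rho] of exceptions at a vertex depends on the layer only. *)
Definition layered c X (b : V -> nat) (mn : V -> C) (rho : nat -> nat) :=
 [/\ {in X & ~: X, forall x y, c [set x; y] = mn x},
     {in X &, forall x y, b x < b y -> c [set x; y] = mn x},
     {in X, forall x,
        #|[set y in X | [&& b y == b x, y != x & c [set x; y] != mn x]]| = rho (b x)}
   & {in X &, forall x y, b x = b y -> x != y ->
        c [set x; y] != mn x -> c [set x; y] = mn y}].

Lemma layered_ext c c' X b mn rho : layered c X b mn rho ->
  (forall e : {set V}, ~~ (e \subset ~: X) -> c' e = c e) -> layered c' X b mn rho.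
Proof.
case=> h1 h2 h3 h4 E; have E' x y : x \in X -> c' [set x; y] = c [set x; y].
  by move=> xX; apply: E; apply/subsetPn; exists x; rewrite ?set21 // inE xX.
split=> [x y xX yX|x y xX yX bxy|x xX|x y xX yX bxy xy]; rewrite ?E' //.
- exact: h1.
- exact: h2.
- rewrite -h3 //; apply: eq_card => y; rewrite !inE E' //.
- exact: h4.
Qed.

(** The vertices attaining the maximal degree [d] are the next layer. As [d]
    exceeds half of the degree, the dominant colour is unique; by saturation an
    edge of another colour leads to a vertex for which that colour is dominant,
    and the number of these edges is the same for all vertices. *)
Lemma layered_add c X b mn rho d L : layered c X b mn rho ->
    {in X, forall x, b x < L} -> saturated c (~: X) d ->
    (forall x i, x \in ~: X -> mono c (~: X) i x <= d) ->
    #|~: X| < d.*2.+1 ->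
  exists b' mn' rho',
    layered c (X :|: [set x in ~: X | [exists i, mono c (~: X) i x == d]]) b' mn' rho' /\
    forall x, x \in X :|: [set x in ~: X | [exists i, mono c (~: X) i x == d]] -> b' x < L.+1.
Proof.
set Y := ~: X; set M := [set x in _ | _] => lay bL sat bd Yd.
have XY x : (x \in Y) = (x \notin X) by rewrite inE.
have XM x : x \in M -> x \notin X by rewrite inE XY => /andP[].
have MY x : x \in M -> x \in Y by rewrite inE => /andP[].
have Md x : x \in Y -> (exists i, mono c Y i x = d) -> x \in M.
  by move=> xY [i xi]; rewrite inE xY; apply/existsP; exists i; apply/eqP.
pose top x (m : C) := odflt m [pick i | mono c Y i x == d].
have topP x m : x \in M -> mono c Y (top x m) x = d.
  rewrite inE => /andP[_ /existsP[i xi]]; rewrite /top; case: pickP => [j /eqP|/(_ i)] //=.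
  by rewrite xi.
pose b' x := if x \in X then b x else L.
pose mn' x := if x \in X then mn x else top x (mn x).
pose rho' l := if l == L then #|Y|.-1 - d else rho l.
exists b', mn', rho'; split; last first.
  move=> x; rewrite inE /b' ltnS; case: ifP => xX //= _.
  by apply: ltnW; apply: bL.
have bM x : x \in M -> b' x = L by move=> /XM/negbTE xX; rewrite /b' xX.
have bX x : x \in X -> b' x = b x by move=> xX; rewrite /b' xX.
have mM x : x \in M -> mono c Y (mn' x) x = d.
  by move=> xM; rewrite /mn' (negbTE (XM _ xM)); apply: topP.
have mX x : x \in X -> mn' x = mn x by move=> xX; rewrite /mn' xX.
have own x y : x \in M -> y \in Y -> y != x -> c [set x; y] != mn' x ->
    y \in M /\ mono c Y (c [set x; y]) y = d.
  move=> xM yY yx cxy; have [h _] := sat _ _ _ (MY _ xM) yY (mM _ xM) yx cxy.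
  by split=> //; apply: Md => //; exists (c [set x; y]).
case: lay => h1 h2 h3 h4; rewrite -/Y in h1.
have rS : forall x, x \in M -> #|[set y in Y | avoid c (mn' x) x y]| = #|Y|.-1 - d.
  by move=> x xM; rewrite -(mono_split c (mn' x) (MY _ xM)) mM // addnK.
have dd x i j : x \in Y -> mono c Y i x = d -> mono c Y j x = d -> i = j.
  move=> xY xi xj; apply/eqP/negPn/negP => ij; have := mono_add c xY ij.
  have : 0 < #|Y| by apply/card_gt0P; exists x.
  by rewrite xi xj; clear -Yd; lia.
have cS x y : c [set x; y] = c [set y; x] by rewrite setUC.
clearbody M Y b' mn'; split.
- move=> x y; rewrite !inE negb_or => /orP[xX|xM] /andP[yX].
    by rewrite mX // => _; apply: h1; rewrite // XY.
  move=> yM; apply/eqP/negPn/negP => cxy; case: (own x y xM _ _ cxy).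
  + by rewrite XY.
  + by apply: contraNneq yM => ->.
  + by rewrite (negbTE yM).
- move=> x y; rewrite !inE => /orP[xX|xM] /orP[yX|yM].
  + by rewrite !bX // mX //; apply: h2.
  + by rewrite mX // => _; apply: h1; rewrite // XY XM.
  + by rewrite bM // bX // => /ltnW/(leq_trans (bL _ yX)); rewrite ltnn.
  + by rewrite !bM // ltnn.
- move=> x; rewrite inE => /orP[xX|xM].
    rewrite bX // /rho' ifF; last by apply/eqP; have := bL _ xX; lia.
    rewrite -h3 //; apply: eq_card => y; rewrite !inE mX //.
    case yX: (y \in X); first by rewrite bX.
    case yM: (y \in M) => //=; rewrite bM //.
    by rewrite (gtn_eqF (bL _ xX)).
  rewrite bM // /rho' eqxx -(rS x xM); apply: eq_card => y; rewrite !inE /avoid /= [x == y]eq_sym.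
  case yM: (y \in M); first by rewrite orbT bM // eqxx (MY _ yM).
  rewrite orbF; case yX: (y \in X).
    by rewrite bX // (ltn_eqF (bL _ yX)) XY yX.
  rewrite XY yX /=; apply/esym/negP => /andP[yx cxy].
  have yY : y \in Y by rewrite XY yX.
  by case: (own x y xM yY yx cxy); rewrite yM.
- move=> x y; rewrite !inE => /orP[xX|xM] /orP[yX|yM].
  + by rewrite !bX // !mX //; apply: h4.
  + by rewrite (bX x xX) (bM y yM) => E; have := bL _ xX; rewrite E ltnn.
  + by rewrite (bM x xM) (bX y yX) => E; have := bL _ yX; rewrite E ltnn.
  + move=> _ xy cxy; rewrite eq_sym in xy.
    have [_ yd] := own x y xM (MY _ yM) xy cxy.
    exact: dd (MY _ yM) yd (mM _ yM).
Qed.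

(** Peeling stops only at a balanced remainder: [d] cannot be smaller than half
    of the degree, because by saturation two colours, with at most [d] edges
    each, would account for all edges at a vertex. *)
Lemma exists_layered c X b mn rho L :
    polychromatic s c -> 2 < #|C| -> 3 < s -> layered c X b mn rho ->
    {in X, forall x, b x < L} ->
  exists c' X' b' mn' rho', [/\ polychromatic s c', layered c' X' b' mn' rho'
    & X' = setT \/ exists d, balanced c' (~: X') d].
Proof.
have [n] := ubnP #|~: X|; elim: n c X b mn rho L => // n IH c X b mn rho L Xn cP C3 s4 lay bL.
case: (eqVneq X setT) => [XT|XT]; first by exists c, X, b, mn, rho; split=> //; left.
have [h1 _ _ _] := lay.
have [c' [d [c'P c'E [bd [v [i [vY vd]]]] sat]]] := exists_saturated cP C3 s4 h1 XT.
have lay' := layered_ext lay c'E.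
have Y0 : 0 < #|~: X| by apply/card_gt0P; exists v.
case: (eqVneq #|~: X| d.*2.+1) => [Yd|Yd].
  exists c', X, b, mn, rho; split => //; right; exists d.
  exact: saturated_balanced sat Yd bd vY vd.
have {}Yd : #|~: X| < d.*2.+1.
  rewrite ltn_neqAle Yd /= leqNgt; apply/negP => lt.
  have E := mono_split c' i vY; rewrite vd in E.
  have /card_gt0P[u] : 0 < #|[set y in ~: X | avoid c' i v y]|.
    by move: E lt Y0; move: #|_| #|_|; clear; lia.
  rewrite inE => /and3P[uY vu cu]; rewrite eq_sym in vu.
  have [_ F] := sat _ _ _ vY uY vd vu cu.
  have := bd v (c' [set v; u]) vY.
  by move: F lt; move: (mono _ _ _ _) #|_|; clear; lia.
have [b' [mn' [rho' [lay2 bL2]]]] := layered_add lay' bL sat bd Yd.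
apply: (IH _ _ _ _ _ L.+1 _ c'P C3 s4 lay2 bL2).
rewrite ltnS in Xn; apply: leq_trans Xn; apply: proper_card; apply/properP; split.
  by apply/subsetP => x; rewrite !inE negb_or => /andP[].
exists v => //; rewrite !inE negbK; apply/orP; right.
by move: vY; rewrite !inE => -> /=; apply/existsP; exists i; rewrite vd.
Qed.

End Layers.

(** * Chvatal's degree condition *)

Section Chvatal.
Variables (V : finType) (W : {set V}).
Implicit Types (E : {set {set V}}) (x y u v : V).

Let adj E : rel V := [rel x y | (x != y) && ([set x; y] \in E)].
Let deg E x := #|[set y in W | adj E x y]|.

Let adjC E : symmetric (adj E).
Proof. by move=> x y; rewrite /adj /= eq_sym setUC. Qed.

Let ham E := [exists p : #|W|.-tuple V, [&& uniq p, all (mem W) p & cycle (adj E) p]].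

Let hamP E : reflect
  (exists p, [/\ size p = #|W|, uniq p, {subset p <= W} & cycle (adj E) p]) (ham E).
Proof.
apply: (iffP existsP) => [[p /and3P[Up /allP pW pc]] | [p [/eqP sp Up pW pc]]].
  by exists p; rewrite size_tuple.
by exists (Tuple sp); rewrite /= Up pc andbT; apply/allP.
Qed.

(* Any enumeration of [W] will do. *)
Let ham_complete E : 2 < #|W| -> {in W &, forall x y, x != y -> adj E x y} -> ham E.
Proof.
move=> W3 cE; apply/hamP; exists (enum W).
have U := enum_uniq (mem W); have sW : size (enum W) = #|W| by rewrite -cardE.
split=> // [x|]; first by rewrite mem_enum.
apply: cycle_from_next => // x xW.
have eW y : (y \in W) = (y \in enum W) by rewrite mem_enum.
apply: cE; rewrite ?eW ?mem_next //.
apply: contraTneq W3 => E'; rewrite -leqNgt -sW.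
case: (rot_to xW) => n q qE; rewrite -(size_rot n) qE.
rewrite -(next_rot n U) qE in E'.
have Uq : uniq (x :: q) by rewrite -qE rot_uniq.
have lx : last x q = x by apply: (can_inj (prev_next Uq)); rewrite next_last.
by case: (q) Uq lx => //= z q' /andP[xq _] E2; rewrite -{1}E2 mem_last in xq.
Qed.

(** Ore's argument: a cycle through the added edge leaves a Hamiltonian path from
    [u] to [v], on which the successors of the neighbours of [v] are not
    adjacent to [u]. *)
Let ore_sum E u v : ~~ ham E -> ham ([set u; v] |: E) -> 2 < #|W| ->
  deg E u + deg E v < #|W|.
Proof.
move=> nE /hamP[p [sp Up pW pc]] W3.
have npc : ~~ cycle (adj E) p by apply: contra nE => h; apply/hamP; exists p.
have keep a b : adj ([set u; v] |: E) a b -> [set a; b] != [set v; u] -> adj E a b.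
  by rewrite /adj /= !inE setUC [[set v; u]]setUC [[set b; a]]setUC => /andP[-> /orP[->|//]].
rewrite -sp in W3.
have [q [uq lq qp]] := cycle_edge_path (@adjC E) keep W3 Up pc npc.
have Uq : uniq (u :: q) by rewrite (perm_uniq qp).
have qW x : (x \in u :: q) = (x \in W).
  have := uniq_min_size Uq (_ : {subset u :: q <= enum W}).
  rewrite -cardE (perm_size qp) sp leqnn => h.
  rewrite -[RHS](mem_enum (mem W)); case: h => // y; rewrite (perm_mem qp) mem_enum; exact: pW.
have uW : u \in W by rewrite -qW mem_head.
rewrite -ltn_subRL /deg.
have -> : #|W| - #|[set y in W | adj E u y]| = #|W :\: [set y in W | adj E u y]|.
  by rewrite cardsD (setIidPr _) //; apply/subsetP => y; rewrite inE => /andP[].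
rewrite -(card_in_imset (f := next (u :: q))); last by move=> ? ? _ _; apply: (can_inj (prev_next Uq)).
apply: proper_card; apply/properP; split; last first.
  exists u; first by rewrite !inE uW /adj /= eqxx.
  apply/imsetP => -[y]; rewrite inE => /andP[yW vy] E'.
  move: vy; have -> : y = v by rewrite -lq; apply: (can_inj (prev_next Uq)); rewrite next_last.
  by rewrite /adj /= eqxx.
apply/subsetP => _ /imsetP[y yN ->]; move: yN; rewrite !inE -!qW mem_next => /andP[yq vy].
rewrite yq andbT /=; apply: contra nE => uy.
have yv : y != last u q by rewrite lq; case/andP: vy; rewrite eq_sym.
have yl : adj E y (last u q) by rewrite lq adjC.
have [r rp rc] := rotation (@adjC E) uq Uq yq yv uy yl.
apply/hamP; exists r; rewrite (perm_size rp) (perm_size qp) (perm_uniq rp); split=> // x.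
by rewrite (perm_mem rp) qW.
Qed.

(** In a maximal non-Hamiltonian supergraph, take non-adjacent [u] and [v] with
    the largest sum of degrees, [u] having the smaller degree. By maximality no
    non-neighbour of [v] has a larger degree than [u], and [ore_sum] shows that
    there are at least as many of them as this degree. *)
Lemma chvatal (F : {set {set V}}) : 2 < #|W| ->
    (forall p, size p = #|W| -> uniq p -> {subset p <= W} -> ~~ cycle (adj F) p) ->
  exists k (T : {set V}), [/\ 0 < k, k.*2 < #|W|, T \subset W, k <= #|T|
    & {in T, forall x, #|[set y in W | (x != y) && ([set x; y] \in F)]| <= k}].
Proof.
move=> W3 nF.
have : ~~ ham F by apply/hamP => -[p [sp Up pW]]; apply/negP/nF.
move/(maxset_exists (P := fun E => ~~ ham E)) => [E /maxsetP[nE maxE] FE].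
have degS x : deg F x <= deg E x.
  apply/subset_leq_card/subsetP => y; rewrite !inE /adj /= => /and3P[-> -> h] /=.
  exact: (subsetP FE).
have addE u v : u != v -> ~~ adj E u v -> ham ([set u; v] |: E).
  move=> uv nuv; apply: contraT => h.
  have E' : [set u; v] |: E = E by apply: maxE (subsetUr _ _); exact: h.
  by move: nuv; rewrite -E' /adj /= uv !inE eqxx.
pose P z := [&& z.1 \in W, z.2 \in W, z.1 != z.2 & ~~ adj E z.1 z.2].
have [z0 Pz0] : exists z, P z.
  apply/existsP; apply: contraR nE => /existsPn nP; apply: ham_complete => // x y xW yW xy.
  by have := nP (x, y); rewrite /P /= xW yW xy /= negbK.
case: (arg_maxnP (fun z => deg E z.1 + deg E z.2) Pz0) => -[u0 v0] Puv maxuv.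
have [u [v [/and4P[/= uW vW uv nuv] duv max2]]] : exists u v, [/\ P (u, v), deg E u <= deg E v &
    forall z, P z -> deg E z.1 + deg E z.2 <= deg E u + deg E v].
  case: (leqP (deg E u0) (deg E v0)) => h; first by exists u0, v0.
  exists v0, u0; split; [|exact: ltnW|by move=> z /maxuv; rewrite [X in _ <= X]addnC].
  by case/and4P: Puv => /= *; apply/and4P; rewrite /= eq_sym adjC.
have sum := ore_sum nE (addE u v uv nuv) W3.
pose T := [set x in W | (x != v) && ~~ adj E v x].
have cT : #|T| + deg E v = #|W|.-1.
  rewrite (cardsD1 v W) vW /= /deg -cardsUI [_ :&: _](_ : _ = set0) ?cards0 ?addn0.
    apply: eq_card => x; rewrite !inE /adj /= [v == x]eq_sym.
    by case: (x \in W); case: (x == v); case: (_ \in E).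
  apply/setP => x; rewrite !inE; case: (adj E v x); rewrite ?andbF //.
have uT : u \in T by rewrite inE uW uv adjC.
have dT x : x \in T -> deg E x <= deg E u.
  rewrite inE => /and3P[xW xv nxv]; have := max2 (x, v); rewrite leq_add2r; apply.
  by apply/and4P; rewrite /= adjC.
have TW : T \subset W by apply/subsetP => x; rewrite inE => /andP[].
have T0 : 0 < #|T| by apply/card_gt0P; exists u.
have [k2 kT] : (maxn 1 (deg E u)).*2 < #|W| /\ maxn 1 (deg E u) <= #|T|.
  move: cT sum duv T0 W3; move: #|T| #|W| (deg E u) (deg E v); clear; lia.
exists (maxn 1 (deg E u)), T; split=> //; first by rewrite leq_max.
move=> x /dT xd; apply: leq_trans (degS x) _; apply: leq_trans xd _; exact: leq_maxr.
Qed.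

End Chvatal.

(** * A level for every colour *)

Lemma exists_initial (V : finType) (A : {set V}) (b : V -> nat) q : q <= #|A| ->
  exists U : {set V}, [/\ U \subset A, #|U| = q & {in U & A :\: U, forall u x, b u <= b x}].
Proof.
elim: q => [|q IH] qA; first by exists set0; rewrite sub0set cards0; split=> // u x; rewrite inE.
have [U [UA Uq Ub]] := IH (ltnW qA).
have [x0 x0P] : exists x, x \in A :\: U.
  by apply/card_gt0P; rewrite cardsD (setIidPr UA) Uq subn_gt0.
case: (arg_minnP (P := fun x => x \in A :\: U) b x0P) => x xP xmin.
have {xP} [xU xA] : x \notin U /\ x \in A by apply/andP; rewrite -in_setD.
exists (x |: U); split.
- by apply/subsetP => y /setU1P[->//|/(subsetP UA)].
- by rewrite cardsU1 xU Uq.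
move=> u y /setU1P[->|uU]; rewrite !inE negb_or -andbA => /and3P[yx yU yA].
  by apply: xmin; rewrite in_setD yU.
by apply: Ub => //; rewrite inE yU.
Qed.

Lemma exists_between (V : finType) (A B : {set V}) q :
  A \subset B -> #|A| <= q <= #|B| ->
  exists U : {set V}, [/\ A \subset U, U \subset B & #|U| = q].
Proof.
move=> AB /andP[Aq qB].
have [|U' [U'A U'q _]] := @exists_initial _ (B :\: A) (fun=> 0) (q - #|A|).
  by rewrite cardsD (setIidPr AB) leq_sub2r.
exists (A :|: U'); split; first exact: subsetUl.
  by rewrite subUset AB; apply: subset_trans U'A (subsetDl _ _).
rewrite cardsU U'q (_ : A :&: U' = set0) ?cards0; first by lia.
by apply/eqP; rewrite setI_eq0; apply: disjointWr U'A _; rewrite disjoints_subset setCD subsetUr.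
Qed.

Section Levels.
Variables (V C : finType) (s q : nat) (c : {ffun {set V} -> C}).
Hypotheses (cP : polychromatic s c) (s4 : 3 < s) (Vs : #|V| = s + q).
Implicit Types (i j : C) (x y z : V).
Variables (X : {set V}) (b : V -> nat) (mn : V -> C) (rho : nat -> nat).
Hypothesis lay : layered c X b mn rho.

(** Without [U] exactly [s] vertices remain, so the graph avoiding [i] is not
    Hamiltonian on them. The degrees of the graph and of its complement are both
    recorded, since which one is useful depends on where the vertex lies. *)
Lemma low_degree i (U : {set V}) : #|U| = q ->
  exists k (T : {set V}), [/\ 0 < k, k.*2 < s, T \subset ~: U, k <= #|T|
    & {in T, forall x, #|[set y in ~: U | avoid c i x y]| <= k /\
                       s.-1 <= k + mono c (~: U) i x}].
Proof.
move=> Uq; have Ws : #|~: U| = s by have := cardsC U; rewrite Uq Vs; lia.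
have [||k [T [k0 ks TW kT Tk]]] := @chvatal V (~: U) [set e | c e != i].
- by rewrite Ws; apply: ltnW.
- rewrite Ws => p sp Up _; have := polychromaticP _ _ cP i p sp Up.
  by rewrite (eq_cycle (e' := avoid c i)) // => x y; rewrite /avoid /= inE.
exists k, T; rewrite -Ws; split=> // x xT.
have E : [set y in ~: U | avoid c i x y] =
      [set y in ~: U | (x != y) && ([set x; y] \in [set e | c e != i])].
  by apply/setP => y; rewrite !inE.
have h := Tk x xT; rewrite -E in h; split=> //.
by rewrite -(mono_split c i (subsetP TW _ xT)) leq_add2r.
Qed.

Let cS x y : c [set x; y] = c [set y; x]. Proof. by rewrite setUC. Qed.

Definition own i := [set x in X | mn x == i].

Lemma ownP i x : reflect (x \in X /\ mn x = i) (x \in own i).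
Proof. by rewrite inE; apply: (iffP andP) => -[h /eqP]. Qed.

(** An edge of colour [i] at a vertex [z] with another main colour is main for
    its other end, hence cannot go forward from [z]. *)
Lemma own_edge i z y : z \in X -> mn z != i -> y != z -> c [set z; y] = i ->
  y \in own i /\ b y <= b z.
Proof.
case: lay => h1 h2 h3 h4 zX mz yz cz.
have yX : y \in X.
  by apply: contraR mz => yX; rewrite -(h1 z y) ?cz // inE.
case: (ltngtP (b y) (b z)) => E.
- by split=> //; apply/ownP; rewrite -(h2 y z) // cS.
- by move: mz; rewrite -(h2 z y) // cz eqxx.
- have zy : z != y by rewrite eq_sym.
  have cm : c [set z; y] != mn z by rewrite cz eq_sym.
  by split=> //; apply/ownP; split => //; rewrite -cz (h4 z y).
Qed.

Definition reach x := #|[set y in own (mn x) | b y <= b x]|.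
(** Competitors of [x], all of them joined to [x] by edges avoiding the main
    colour of [x]: vertices of earlier layers with another main colour, and
    exceptions in the layer of [x]. *)
Definition before x := #|[set y in X | (mn y != mn x) && (b y < b x)]| + rho (b x).
Let foe x := [set y in X | (mn y != mn x) && avoid c (mn x) x y].

Lemma before_le x : x \in X -> before x <= #|foe x|.
Proof.
case: lay => h1 h2 h3 h4 xX; rewrite /before -h3 // -cardsUI.
rewrite [_ :&: _](_ : _ = set0) ?cards0 ?addn0; last first.
  by apply/setP => y; rewrite !inE; case: (ltngtP (b y)) => //=; rewrite ?andbF.
apply/subset_leq_card/subsetP => y; rewrite !inE => /orP[/and3P[yX my bxy]|].
  rewrite yX my /avoid /= cS (h2 y x) // my andbT.
  by apply: contraTneq bxy => ->; rewrite ltnn.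
case/and4P=> yX /eqP E yx cx.
have xy : x != y by rewrite eq_sym.
by rewrite yX /avoid /= xy cx !andbT -(h4 x y) // E.
Qed.

(** The model is the last vertex of a level in an ordered colouring. *)
Definition leveled i := exists2 x, x \in own i &
  [/\ q + before x <= reach x, q < reach x & (before x).*2 < s].

(** The form in which [leveled] is established: [U] is an initial part of
    [own i], and [A] a set of at least [k] further vertices of [own i], the last
    of which has few competitors. *)
Lemma leveled_of i (A U : {set V}) k x : U \subset own i -> #|U| = q -> x \in A ->
    A \subset own i :\: U -> (forall y, y \in A -> b y <= b x) ->
    {in U & own i :\: U, forall u x, b u <= b x} ->
    0 < k -> k.*2 < s -> k <= #|A| -> #|foe x| <= k -> leveled i.
Proof.
move=> UI Uq xA AI Ax Ub k0 ks kA kx.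
have xI : x \in own i by have := subsetP AI _ xA; rewrite inE => /andP[].
have [xX xi] := ownP _ _ xI.
have r : q + k <= reach x.
  rewrite -Uq; apply: leq_trans (_ : #|U :|: A| <= _).
    rewrite cardsU (_ : U :&: A = set0) ?cards0 ?subn0 ?leq_add2l //.
    apply/setP => y; rewrite !inE; apply/negP => /andP[yU /(subsetP AI)].
    by rewrite inE yU.
  apply/subset_leq_card/subsetP => y; rewrite !inE xi -/(own i) => /orP[yU|yA].
    have /ownP[-> ->] := subsetP UI _ yU; rewrite eqxx /=.
    by apply: Ub => //; apply: (subsetP AI).
  have := subsetP AI _ yA; rewrite inE => /andP[_ /ownP[-> ->]].
  by rewrite eqxx Ax.
have := before_le xX; exists x => //; split; lia.
Qed.

Let mono_own i (U : {set V}) z : z \in X -> mn z != i ->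
  [set y in ~: U | (y != z) && (c [set z; y] == i)] \subset own i :\: U.
Proof.
move=> zX mz; apply/subsetP => y; rewrite !inE => /and3P[yU yz /eqP cz].
by have [/ownP[-> ->] _] := own_edge zX mz yz cz; rewrite yU eqxx.
Qed.

Let mono_rest i (U : {set V}) z : z \in ~: X ->
  mono c (~: U) i z <= #|own i :\: U| + mono c (~: X) i z.
Proof.
case: lay => h1 _ _ _ zX.
apply: leq_trans (leq_card_setU _ _).
apply/subset_leq_card/subsetP => y; rewrite !inE => /and3P[yU yz /eqP cz].
rewrite yU yz cz eqxx !andbT /=; case yX: (y \in X) => //=.
by rewrite -(h1 y z) // cS cz eqxx.
Qed.

(** Apply [low_degree] to the first [q] vertices [U] of [own i]. If the vertices
    of low degree all have main colour [i], the last one is as desired. If one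
    of them lies in [X] but has another main colour, its many edges of colour
    [i] lead to vertices of [own i] in its layer or earlier ones, and the last
    of these is as desired. If one lies outside [X], where the colours are
    balanced, its low degree implies that [X] is small or that [own i] is at
    least half of [X]; then the last vertex of [own i] is as desired. *)
Lemma level_or_small i : X = setT \/ (exists d, balanced c (~: X) d) ->
  leveled i \/ (#|X| <= q /\ exists d, balanced c (~: X) d).
Proof.
move=> term; case: (leqP q #|own i|) => pq; last first.
  have [|U [IU _ Uq]] := @exists_between _ (own i) setT q (subsetT _).
    by rewrite (ltnW pq) cardsT Vs leq_addl.
  have [k [T [k0 ks TW kT Tk]]] := low_degree i Uq.
  have [z zT] : exists z, z \in T by apply/card_gt0P; apply: leq_trans kT.
  have zW := subsetP TW _ zT; have [_ low] := Tk z zT.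
  have E0 : own i :\: U = set0 by apply/eqP; rewrite setD_eq0.
  case zX: (z \in X).
    have mz : mn z != i.
      apply: contraTneq zW => mz; rewrite inE negbK; apply: (subsetP IU).
      by apply/ownP.
    have := subset_leq_card (mono_own U zX mz); rewrite E0 cards0.
    by move: low ks; rewrite /mono; move: #|_|; clear -s4; lia.
  right; case: term => [E|[d bal]]; first by rewrite E inE in zX.
  split; last by exists d.
  have zY : z \in ~: X by rewrite inE zX.
  case: (bal) => Yd bd _; have := bd z i zY; have := mono_rest i U zY.
  rewrite E0 cards0 add0n; have := cardsC X; rewrite Yd Vs.
  by move: low ks; move: (mono _ _ _ _) (mono _ _ _ _) #|_|; clear -s4; lia.
(* [U] consists of earliest vertices, so that up to the layer of any vertex of
   [own i] outside [U] all of [U] is present. *)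
have [U [UI Uq Ub]] := exists_initial b pq.
have [k [T [k0 ks TW kT Tk]]] := low_degree i Uq.
have foeW x : x \in own i -> foe x \subset [set y in ~: U | avoid c i x y].
  case/ownP=> xX xi; apply/subsetP => y; rewrite !inE xi => /and3P[yX yi ->].
  by rewrite andbT; apply: contra yi => /(subsetP UI)/ownP[_ ->].
case: (boolP (T \subset own i :\: U)) => [TI|/subsetPn[z zT zI]].
  have [z zT] : exists z, z \in T by apply/card_gt0P; apply: leq_trans kT.
  case: (arg_maxnP (P := fun x => x \in T) b zT) => x xT xmax; left.
  apply: (leveled_of UI Uq xT TI) kT _ => //.
  have [xk _] := Tk x xT; apply: leq_trans xk; apply/subset_leq_card/foeW.
  by have := subsetP TI _ xT; rewrite inE => /andP[].
have zW := subsetP TW _ zT; have [_ low] := Tk z zT.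
have {}zI : z \notin own i by move: zI; rewrite in_setD -in_setC zW.
case zX: (z \in X).
  have mz : mn z != i by apply: contra zI => /eqP mz; apply/ownP.
  have AI := mono_own U zX mz; move: low; rewrite /mono.
  set A := [set y in _ | _] in AI * => low.
  have Ak : k <= #|A| by move: low ks; move: #|A|; clear; lia.
  have [y0 y0A] : exists y, y \in A by apply/card_gt0P; apply: leq_trans Ak.
  case: (arg_maxnP (P := fun x => x \in A) b y0A) => x xA xmax; left.
  apply: (leveled_of UI Uq xA AI) Ak _ => //.
  have /ownP[xX xi] : x \in own i by have := subsetP AI _ xA; rewrite inE => /andP[].
  suff : #|foe x| + #|z |: A| <= s.
    rewrite cardsU1 (_ : z \notin A); last by rewrite !inE eqxx andbF.
    by move: low; move: #|A| #|_|; clear -s4; lia.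
  have <- : #|~: U| = s by have := cardsC U; rewrite Uq Vs; clear; lia.
  rewrite -[#|foe x|]addn0 -[X in _ + X + _](cards0 V).
  have E : foe x :&: (z |: A) = set0.
    apply/setP => y; rewrite in_set0; apply/negP => /setIP[yf].
    move: yf; rewrite inE xi => /and3P[yX my xy] /setU1P[yz|yA].
      move: xA xy; rewrite yz inE cS => /and3P[_ _ /eqP E].
      by rewrite /avoid /= E eqxx andbF.
    by have := subsetP AI _ yA; rewrite inE => /andP[_ /ownP[_ E]]; rewrite E eqxx in my.
  rewrite cards0 addn0 -cardsUI E cards0 addn0; apply: subset_leq_card.
  rewrite subUset subUset sub1set zW; apply/and3P; split=> //.
    apply: subset_trans (foeW x _) _; first by apply/ownP.
    by apply/subsetP => y; rewrite inE => /andP[].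
  by apply/subsetP => y; rewrite inE => /andP[].
case: term => [E|[d bal]]; first by rewrite E inE in zX.
have zY : z \in ~: X by rewrite inE zX.
case: (bal) => Yd bd _; have Xs := cardsC X; rewrite Yd Vs in Xs.
have oX : #|own i| <= #|X| by apply/subset_leq_card/subsetP => y /ownP[].
case: (leqP #|own i| q) => oq.
  right; split; last by exists d.
  have := bd z i zY; have := mono_rest i U zY; rewrite cardsD (setIidPr UI) Uq.
  move: low ks; move: (mono _ _ _ _) (mono _ _ _ _) Xs oX oq; move: #|X| #|own i|.
  by clear -s4; lia.
have oX2 : #|X| + q <= #|own i|.*2.
  have := bd z i zY; have := mono_rest i U zY; rewrite cardsD (setIidPr UI) Uq.
  move: low ks; move: (mono _ _ _ _) (mono _ _ _ _) Xs oX oq; move: #|X| #|own i|.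
  by clear -s4; lia.
left; have [y0 y0I] : exists y, y \in own i by apply/card_gt0P; apply: leq_trans oq.
case: (arg_maxnP (P := fun x => x \in own i) b y0I) => x xI xmax.
have /ownP[xX xi] := xI.
have rE : reach x = #|own i|.
  apply: eq_card => y; rewrite inE xi -/(own i); case yI: (y \in own i) => //=.
  exact: xmax.
have fX : #|foe x| + #|own i| <= #|X|.
  rewrite -cardsUI (_ : _ :&: _ = set0) ?cards0 ?addn0.
    apply: subset_leq_card; rewrite subUset; apply/andP; split.
      by apply/subsetP => y; rewrite inE => /andP[].
    by apply/subsetP => y /ownP[].
  by apply/setP => y; rewrite !inE xi; case: eqP; rewrite ?andbF.
have := before_le xX => bx; exists x => //; rewrite rE.
by split; move: bx fX oX2 Xs oq; move: #|X| #|own i| #|foe x| (before x); clear; lia.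
Qed.

(** * Excluding a balanced remainder *)
Section Balanced.
Variable d : nat.
Hypotheses (Xq : #|X| <= q) (bal : balanced c (~: X) d) (sq : 4 * q <= s.+1).
Let Y := ~: X.

Let XYs : #|X| + d.*2.+1 = s + q.
Proof. by have := cardsC X; case: bal => -> _ _; rewrite Vs. Qed.

Let d2 : 1 < d. Proof. by move: XYs Xq s4; move: #|X|; clear; lia. Qed.

Let XY x : (x \in Y) = (x \notin X). Proof. by rewrite inE. Qed.

Lemma mono_sum (Z : {set V}) x : x \in Z -> \sum_j mono c Z j x = #|Z|.-1.
Proof.
move=> xZ; rewrite (cardsD1 x Z) xZ add1n /= -sum1_card.
rewrite (partition_big (fun y => c [set x; y]) predT) //=.
apply: eq_bigr => j _; rewrite sum1dep_card; apply: eq_card => y.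
by rewrite !inE; case: (y == x); case: (y \in Z).
Qed.

Let mono_half x j : x \in Y -> mono c Y j x != 0 -> mono c Y j x = d.
Proof.
move=> xY; case: (bal) => Yd _ /(_ (ltnW d2) x xY)[i1 [i2 [i12 h1 h2]]].
case: (eqVneq j i1) => [->//|j1]; case: (eqVneq j i2) => [->//|j2].
have := mono_sum xY; rewrite Yd (bigD1 i1) //= (bigD1 i2) 1?eq_sym //=.
rewrite (bigD1 j) /= ?j1 // h1 h2; move: (\sum_(_ | _) _) (mono _ _ _ _).
by clear; lia.
Qed.

Let see j := [set x in Y | mono c Y j x != 0].

(** A vertex of low degree in the graph avoiding [j] sees [j], hence has [d]
    neighbours along this colour, which see [j] as well. *)
Let see_card j : d < #|see j|.
Proof.
have [|U [IU _ Uq]] := @exists_between _ (own j) setT q (subsetT _).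
  rewrite cardsT Vs leq_addl andbT; apply: leq_trans Xq.
  by apply/subset_leq_card/subsetP => y /ownP[].
have [k [T [k0 ks TW kT Tk]]] := low_degree j Uq.
have [z zT] : exists z, z \in T by apply/card_gt0P; apply: leq_trans kT.
have zW := subsetP TW _ zT; have [_ low] := Tk z zT.
have E0 : own j :\: U = set0 by apply/eqP; rewrite setD_eq0.
case zX: (z \in X).
  have mz : mn z != j.
    apply: contraTneq zW => mz; rewrite inE negbK; apply: (subsetP IU).
    by apply/ownP.
  have := subset_leq_card (mono_own U zX mz); rewrite E0 cards0.
  by move: low ks; rewrite /mono; move: #|_|; clear -s4; lia.
have zY : z \in Y by rewrite XY zX.
have z0 : mono c Y j z != 0.
  have := mono_rest j U zY; rewrite E0 cards0 add0n -/Y.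
  by move: low ks; move: (mono _ _ _ _) (mono _ _ _ _); clear -s4; lia.
have zd := mono_half zY z0; rewrite /mono in zd.
set N := [set _ in _ | _] in zd; rewrite -zd.
apply: leq_trans (_ : #|z |: N| <= _).
  by rewrite cardsU1 (_ : z \notin N) // !inE eqxx andbF.
apply/subset_leq_card/subsetP => y /setU1P[->|].
  by rewrite in_set zY.
move=> yN; rewrite [y \in see j]in_set; move: yN.
rewrite inE -/Y => /and3P[yY yz /eqP cz]; rewrite yY /=.
rewrite -lt0n; apply/card_gt0P; exists z.
by rewrite inE zY eq_sym yz cS cz eqxx.
Qed.

Let see_sum : \sum_j #|see j| <= 2 * #|Y|.
Proof.
have -> : \sum_j #|see j| = \sum_j \sum_(x in Y) (mono c Y j x != 0).
  apply: eq_bigr => j _; rewrite -sum1_card big_mkcond [RHS]big_mkcond /=.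
  by apply: eq_bigr => x _; rewrite [x \in see j]in_set; case: (x \in Y); case: (_ != 0).
rewrite exchange_big /= mulnC -sum_nat_const; apply: leq_sum => x xY.
have d0 : 0 < d by apply: ltnW.
rewrite -(leq_pmul2r d0) big_distrl /=; case: (bal) => Yd _ _.
apply: leq_trans (_ : \sum_j mono c Y j x <= _).
  apply: leq_sum => j _; case: (eqVneq (mono c Y j x) 0) => [//|h].
  by rewrite (mono_half xY h) mul1n.
by rewrite (mono_sum xY) Yd /= mul2n.
Qed.

Let few_colors : #|C| <= 3.
Proof.
have : #|C| * d.+1 <= 2 * d.*2.+1.
  case: (bal) => <- _ _; apply: leq_trans see_sum.
  by rewrite -sum_nat_const; apply: leq_sum => j _; apply: see_card.
case: (leqP #|C| 3) => // h1 h2.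
have : 4 * d.+1 <= 2 * d.*2.+1 by apply: leq_trans h2; rewrite leq_mul2r h1 orbT.
by clear; lia.
Qed.

(** With three colours each vertex of [Y] sees exactly two of them, so [Y] splits
    into three classes according to the colour that is missed, and edges between
    the classes missing [i] and [l] have the third colour [j]. Remove [own j]
    and part of the larger one of these two classes. The vertices of low degree
    in the graph avoiding [j] then lie in the rest of that class, which is too
    small to contain [k] of them: the degree is at least the size of the third
    class, and at least [d] up to the vertices removed. *)
Lemma no_small_balanced : 3 < #|C| \/ (#|C| = 3 /\ 0 < q) -> False.
Proof.
case=> [|[C3 q0]]; first by rewrite ltnNge few_colors.
have four (r : seq C) : uniq r -> size r = 4 -> False.
  by move=> Ur r4; have := max_card (mem r); rewrite (card_uniqP Ur) r4 C3.
pose miss j := Y :\: see j.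
have missP x j : (x \in miss j) = (x \in Y) && (mono c Y j x == 0).
  by rewrite in_setD in_set; case: (x \in Y); rewrite ?andbF //= ?andbT negbK.
have missE j x y : x \in miss j -> y \in Y -> y != x -> c [set x; y] != j.
  rewrite missP => /andP[xY /eqP m0] yY yx; apply: contra_eqN m0 => cj.
  by rewrite -lt0n; apply/card_gt0P; exists y; rewrite inE yY yx.
have missD i l x : i != l -> x \in miss i -> x \in miss l -> False.
  rewrite !missP => il /andP[xY /eqP xi] /andP[_ /eqP xl].
  case: (bal) => _ _ /(_ (ltnW d2) x xY)[i1 [i2 [i12 h1 h2]]].
  have n1 : i1 != i by apply: contraTneq d2 => E; rewrite -h1 E xi.
  have n2 : i1 != l by apply: contraTneq d2 => E; rewrite -h1 E xl.
  have n3 : i2 != i by apply: contraTneq d2 => E; rewrite -h2 E xi.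
  have n4 : i2 != l by apply: contraTneq d2 => E; rewrite -h2 E xl.
  by apply: (four [:: i1; i2; i; l]) => //=; rewrite !inE !negb_or i12 n1 n2 n3 n4 il.
have miss_card j : #|miss j| + #|see j| = d.*2.+1.
  case: (bal) => <- _ _; rewrite addnC -(cardsID (see j) Y) (_ : Y :&: see j = see j) //.
  by apply/setIidPr/subsetP => x; rewrite in_set => /andP[].
(* The graph avoiding [j] is considered: the class missing [j] is the largest
   one if [X] is empty, and otherwise [j] is not the main colour of all of [X];
   each alternative makes one of the final inequalities strict. *)
have [j [maxj ownj]] : exists j, (#|X| = 0 -> forall l, #|miss l| <= #|miss j|) /\
    (#|X| = 0 \/ #|own j| < #|X|).
  have [j0 _] : exists j0 : C, j0 \in C by apply/card_gt0P; rewrite C3.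
  case: (posnP #|X|) => X0.
    case: (arg_maxnP (P := predT) (fun j => #|miss j|) (erefl : predT j0)) => j _ jmax.
    by exists j; split=> [_ l|]; [exact: jmax | left].
  have [j1 [j2 [_ _ j12]]] : exists j1 j2 : C, [/\ j1 \in C, j2 \in C & j1 != j2].
    by apply/card_gt1P; rewrite C3.
  have oX j : #|own j| <= #|X| by apply/subset_leq_card/subsetP => y /ownP[].
  have s12 : #|own j1| + #|own j2| <= #|X|.
    rewrite -cardsUI (_ : _ :&: _ = set0) ?cards0 ?addn0.
      by apply/subset_leq_card/subsetP => y /setUP[] /ownP[].
    apply/setP => y; rewrite !inE; case: (y \in X) => //=.
    by apply/negP => /andP[/eqP-> /eqP E]; rewrite E eqxx in j12.
  have [h|h] : #|own j1| < #|X| \/ #|own j2| < #|X|.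
    by move: s12 X0; move: #|_| #|_| #|_|; clear; lia.
  - by exists j1; split=> [E|]; [rewrite E in X0 | right].
  - by exists j2; split=> [E|]; [rewrite E in X0 | right].
have oX : #|own j| <= #|X| by apply/subset_leq_card/subsetP => y /ownP[].
have pq : #|own j| < q.
  by move: oX ownj Xq q0; move: #|X| #|own j|; clear; lia.
have [i [l [ij lj il ileq]]] : exists i l, [/\ i != j, l != j, i != l & #|miss i| <= #|miss l|].
  have /card_gt1P[i [l []]] : 1 < #|[set~ j]| by rewrite cardsC1 C3.
  rewrite !inE => ij lj il; case: (leqP #|miss i| #|miss l|) => h.
    by exists i, l.
  by exists l, i; split=> //; [rewrite eq_sym | exact: ltnW].
have three k : k != i -> k != l -> k = j.
  move=> ki kl; apply/eqP/negPn/negP => kj.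
  by apply: (four [:: k; i; j; l]) => //=; rewrite !inE !negb_or ki kj kl ij il eq_sym lj.
have il_edge x y : x \in miss i -> y \in miss l -> c [set x; y] = j.
  move=> xi yl; have yx : y != x by apply/eqP => E; apply: (missD i l x) => //; rewrite -E.
  apply: three; first by apply: missE yx => //; move: yl; rewrite missP => /andP[].
  by rewrite cS; apply: missE yl _ _; [move: xi; rewrite missP => /andP[] | rewrite eq_sym].
have see_miss : #|see j| <= #|miss i| + #|miss l|.
  apply: leq_trans (leq_card_setU _ _); apply/subset_leq_card/subsetP => x.
  rewrite in_set => /andP[xY xj]; rewrite in_setU !missP xY /=.
  case: (eqVneq (mono c Y i x) 0) => //= xi; apply/negPn/negP => xl.
  have := mono_sum xY; rewrite (bigD1 i) //= (bigD1 j) 1?eq_sym //= (bigD1 l) /=; last by rewrite eq_sym il.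
  case: (bal) => -> _ _; rewrite (mono_half xY xi) (mono_half xY xj) (mono_half xY xl).
  by move: (\sum_(_ | _) _) => n; move: d2; clear; lia.
have missY k : miss k \subset Y by apply: subsetDl.
have ql : q - #|own j| <= #|miss l|.
  by move: (see_card j) see_miss ileq XYs Xq sq q0; move: #|_| #|_| #|_| #|_| #|_|; clear; lia.
have [U' [U'l U'q _]] := exists_initial (fun=> 0) ql.
have ownX : own j \subset X by apply/subsetP => x /ownP[].
have oU' : own j :&: U' = set0.
  apply/eqP; rewrite setI_eq0; apply: disjointWl ownX _; apply: disjointWr U'l _.
  by apply: disjointWr (missY l) _; rewrite disjoints_subset setCK.
pose U := own j :|: U'.
have Uq : #|U| = q by rewrite cardsU oU' cards0 U'q; move: pq; clear; lia.
have [k [T [k0 ks TW kT Tk]]] := low_degree j Uq.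
have own0 : own j :\: U = set0 by apply/eqP; rewrite setD_eq0 subsetUl.
have XW : X :\: own j \subset ~: U.
  apply/subsetP => x; rewrite in_setD in_setC in_setU negb_or => /andP[-> xX] /=.
  by apply: contraL xX => xU; rewrite -XY (subsetP (missY l)) // (subsetP U'l).
have [lay1 _ _ _] := lay.
have XN z x : z \in Y -> x \in X :\: own j -> avoid c j z x.
  move=> zY; rewrite in_setD => /andP[xo xX]; rewrite /avoid /= cS (lay1 x z) //.
  apply/andP; split; first by apply: contraTneq zY => ->; rewrite XY negbK.
  by apply: contra xo => /eqP mx; apply/ownP.
have cXo : #|X :\: own j| = #|X| - #|own j| by rewrite cardsD (setIidPr ownX).
have degT z (B : {set V}) : z \in T -> z \in Y -> B \subset Y :&: ~: U ->
    (forall y, y \in B -> avoid c j z y) -> #|B| + (#|X| - #|own j|) <= k.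
  move=> zT zY BY Bz; have [h _] := Tk z zT; apply: leq_trans h.
  rewrite -cXo -cardsUI (_ : B :&: _ = set0) ?cards0 ?addn0; last first.
    apply/eqP; rewrite setI_eq0; apply: disjointWl (subset_trans BY (subsetIl _ _)) _.
    apply: disjointWr (subsetDl _ _) _.
    by rewrite disjoint_sym disjoints_subset setCK.
  apply/subset_leq_card/subsetP => y /setUP[yB|yX]; rewrite in_set.
    by rewrite Bz // andbT; have /setIP[] := subsetP BY _ yB.
  by rewrite (subsetP XW) //= XN.
have Tml z : z \in T -> z \in miss l :\: U'.
  move=> zT; have zW := subsetP TW _ zT; have [_ low] := Tk z zT.
  case zX: (z \in X).
    have mz : mn z != j.
      by apply: contraTneq zW => mz; rewrite in_setC negbK in_setU; apply/orP; left; apply/ownP.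
    have := subset_leq_card (mono_own U zX mz); rewrite own0 cards0.
    by move: low ks; rewrite /mono; move: #|_|; clear -s4; lia.
  have zY : z \in Y by rewrite XY zX.
  have := mono_rest j U zY; rewrite own0 cards0 add0n -/Y => h.
  have mj : mono c Y j z = d.
    apply: mono_half => //.
    by move: low ks h; move: (mono _ _ _ _) (mono _ _ _ _); clear -s4; lia.
  have YN : #|[set y in Y | avoid c j z y]| = d.
    by have := mono_split c j zY; rewrite mj; case: (bal) => -> _ _; clear; lia.
  have zU' : z \notin U' by move: zW; rewrite in_setC in_setU negb_or => /andP[].
  case zl: (z \in miss l); first by rewrite in_setD zU' zl.
  have zi : z \in miss i.
    rewrite missP zY /=; apply/negPn/negP => zi0.
    have zl0 : mono c Y l z != 0 by move: zl; rewrite missP zY /= => ->.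
    have := mono_sum zY; rewrite (bigD1 i) //= (bigD1 j) 1?eq_sym //= (bigD1 l) /=; last by rewrite eq_sym il.
    case: (bal) => -> _ _; rewrite (mono_half zY zi0) mj (mono_half zY zl0).
    by move: (\sum_(_ | _) _) => n; move: d2; clear; lia.
  have := degT z [set y in Y | avoid c j z y] zT zY; rewrite YN => /(_ _ _)H.
  suff : d + (#|X| - #|own j|) <= k.
    by move: XYs ks oX pq ownj Xq; move: #|X| #|own j|; clear; lia.
  apply: H => [|y]; last by rewrite in_set => /andP[].
  apply/subsetP => y; rewrite in_set => /andP[yY zy]; rewrite in_setI yY in_setC in_setU negb_or /=.
  apply/andP; split.
    by move: yY; rewrite XY; apply: contra => /(subsetP ownX).
  apply/negP => /(subsetP U'l) yl; move: zy; rewrite /avoid /= (il_edge z y zi yl) eqxx.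
  by rewrite andbF.
have [z zT] : exists z, z \in T by apply/card_gt0P; apply: leq_trans kT.
have zl : z \in miss l by have := Tml z zT; rewrite in_setD => /andP[].
have zY := subsetP (missY l) _ zl.
have kl : k + (q - #|own j|) <= #|miss l|.
  rewrite addnC -U'q -leq_subRL ?subset_leq_card //.
  rewrite -cardsDS // ; apply: leq_trans kT _.
  by apply/subset_leq_card/subsetP => y /Tml.
have zj : mono c Y j z = d.
  apply: mono_half => //; apply/negP => E.
  by apply: (missD j l z) => //; rewrite ?missP ?zY // eq_sym.
have Yo y : y \in Y -> y \notin own j.
  by rewrite XY; apply: contra => /(subsetP ownX).
(* All edges from [z] to the third class avoid [j], which is missed there. *)
have k1 : #|miss j| + (#|X| - #|own j|) <= k.
  apply: (degT z _ zT zY) => [|y yj].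
    apply/subsetP => y yj; have yY := subsetP (missY j) _ yj.
    rewrite in_setI yY in_setC in_setU negb_or Yo //=.
    by apply/negP => /(subsetP U'l) /(missD j l y _ yj); apply; rewrite eq_sym.
  have zy : z != y by apply/eqP => E; apply: (missD j l y) => //; rewrite -?E // eq_sym.
  by rewrite /avoid /= zy cS; apply: missE yj zY zy.
(* [z] has [d] edges in [Y] that avoid [j]; at most the removed ones are lost. *)
have k2 : d - (q - #|own j|) + (#|X| - #|own j|) <= k.
  have := mono_split c j zY; rewrite zj; case: (bal) => -> _ _; set N := [set _ in _ | _] => Nd.
  apply: leq_trans (_ : #|N :\: U'| + (#|X| - #|own j|) <= _).
    have I : #|N :&: U'| <= q - #|own j| by rewrite -U'q; apply/subset_leq_card/subsetIr.
    rewrite leq_add2r cardsD.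
    by move: Nd I; move: #|N| #|_ :&: _| (q - _); clear; lia.
  apply: (degT z _ zT zY) => [|y].
    apply/subsetP => y; rewrite in_setD => /andP[yU' yN].
    have yY : y \in Y by move: yN; rewrite in_set => /andP[].
    by rewrite in_setI yY in_setC in_setU negb_or Yo.
  by rewrite in_setD in_set => /and3P[].
have := miss_card l; have := see_card l.
move: kl k1 k2 maxj ownj pq d2 => kl k1 k2 maxj ownj pq _.
case: ownj => [X0|oX0].
  have := maxj X0 l; move: kl k1 X0 oX pq q0.
  by move: #|miss l| #|miss j| #|X| #|own j|; clear; lia.
move: kl k2 oX0 pq.
by move: #|miss l| #|see l| #|X| #|own j|; clear; lia.
Qed.

End Balanced.
End Levels.

(** * Growth of the levels *)

(** Two colours with their level in the same layer, in which they have [m1] and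
    [m2] vertices, [p1] and [p2] being the numbers of their earlier vertices. The
    product bound says [(m1 - r) * (m2 - r) <= r ^ 2], because each of the
    [m1 * m2] edges between the two classes is exceptional at one end. As the first
    two hypotheses bound [m1 - r] and [m2 - r] from below by [w] plus or minus
    [p2 - p1], they force [r] to be large, or [p1] and [p2] to differ. *)
Lemma two_color_growth m1 m2 p1 p2 r w :
    w + p2 + r <= m1 + p1 -> w + p1 + r <= m2 + p2 ->
    m1 * m2 <= r * (m1 + m2) -> 0 < m1 -> 0 < m2 ->
  (w <= p1 + r \/ w <= p2 + r) /\
  [/\ 3 * w <= m1 + m2 + p1 + p2, 2 <= m1 + m2 + p1 + p2,
      w = 1 -> 4 <= m1 + m2 + p1 + p2 & 1 < w -> 3 * w + 2 <= m1 + m2 + p1 + p2].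
Proof.
wlog p12 : m1 m2 p1 p2 / p1 <= p2 => [H|] h1 h2 h3 m1p m2p.
  case: (leqP p1 p2) => h; first exact: H.
  have h3' : m2 * m1 <= r * (m2 + m1) by lia.
  have [h4 [h5 h6 h7 h8]] := H m2 m1 p2 p1 (ltnW h) h2 h1 h3' m2p m1p.
  by split; [case: h4; [right|left] | split => *; lia].
have r0 : 0 < r by case: (posnP r) h3 => // ->; rewrite mul0n; lia.
case: (leqP w (p2 - p1)) => dw.
  by split; [right; lia | split; lia].
have hr : (w + (p2 - p1)) * (w - (p2 - p1)) <= r * r.
  have [x xE] : exists x, m1 = r + (w + (p2 - p1)) + x.
    by exists (m1 - (r + (w + (p2 - p1)))); lia.
  have [y yE] : exists y, m2 = r + (w - (p2 - p1)) + y.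
    by exists (m2 - (r + (w - (p2 - p1)))); lia.
  move: h3; rewrite {}xE {}yE; move: (w + _) (w - _) => a b; clear; nia.
have rw : w - (p2 - p1) <= r.
  rewrite leqNgt; apply/negP => lt.
  have : r * r < (w - (p2 - p1)) * (w - (p2 - p1)) by rewrite ltn_mul.
  have : (w - (p2 - p1)) * (w - (p2 - p1)) <= (w + (p2 - p1)) * (w - (p2 - p1)).
    by rewrite leq_mul2r; apply/orP; right; lia.
  lia.
split; first by right; lia.
case: (leqP (p2 - p1 + 2) w) => d2; first by split; lia.
have E : w = (p2 - p1).+1 by lia.
case: (leqP w 1) => w1; first by split; lia.
have r2 : 1 < r.
  rewrite ltnNge; apply/negP => r1; have {r0 r1} rE : r = 1 by lia.
  by move: hr; rewrite rE E; move: w1; rewrite E; clear; nia.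
by split; lia.
Qed.

(** The numerical content of a layered colouring: colour [i] has its level in
    layer [l i], with reach [a i]; [m u i] is the number of its vertices in layer
    [u], and [P u i] that in earlier layers. The function [g] stands for any
    sequence growing no faster than the totals of the reaches do. *)
Section Growth.
Variables (C : finType) (q : nat) (l a : C -> nat) (P m : nat -> C -> nat).
Variables (rho g : nat -> nat).
Hypotheses (aE : forall i, a i = P (l i) i + m (l i) i)
  (P_mono : forall i u v, u < v -> P u i + m u i <= P v i)
  (aq : forall i, q < a i) (m0 : forall i, 0 < m (l i) i)
  (ab : forall i, q + (\sum_(j | j != i) P (l i) j + rho (l i)) <= a i)
  (exceptions : forall u (G : {set C}), \sum_(i in G) m u i * (\sum_(j in G) m u j - m u i)
                    <= 2 * rho u * \sum_(i in G) m u i).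
Hypotheses (g0 : g 0 = 0) (g1 : g 1 <= q.+1)
  (gS : forall j, 0 < j -> g j.+1 <= 2 * g j + q)
  (g2 : g 2 <= match q with 0 => 2 | 1 => 4 | _ => 3 * q + 2 end)
  (g3 : q = 0 -> g 3 <= 3).

Let J u := [set i | l i < u].
Let S u := \sum_(i in J u) a i.
Let G u := [set i | l i == u].

Let JS u : J u.+1 = J u :|: G u.
Proof. by apply/setP => i; rewrite !inE ltnS leq_eqVlt orbC. Qed.

Let JG u : [disjoint J u & G u].
Proof. by rewrite -setI_eq0; apply/eqP/setP => i; rewrite !inE; case: ltngtP. Qed.

Let SS u : S u.+1 = S u + \sum_(i in G u) a i.
Proof. by rewrite /S JS -bigU ?JG //; apply: eq_bigl => i; rewrite !inE. Qed.

Let cJS u : #|J u.+1| = #|J u| + #|G u|.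
Proof. by rewrite JS cardsU (eqP (_ : J u :&: G u == set0)) ?cards0 ?subn0 // setI_eq0. Qed.

Let others u i : i \in G u ->
  S u + \sum_(j in G u | j != i) P u j <= \sum_(j | j != i) P u j.
Proof.
move=> iG; rewrite /S big_mkcond [X in _ + X]big_mkcond [X in _ <= X]big_mkcond -big_split /=.
move: iG; rewrite inE => /eqP iu; apply: leq_sum => j _; rewrite !inE.
case: (ltngtP (l j) u) => h /=; rewrite ?addn0 ?add0n //.
have -> : j != i by apply: contraTneq h => ->; rewrite iu ltnn.
by rewrite aE; apply: P_mono.
Qed.

Lemma level_one_color u i : G u = [set i] ->
  S u + q <= a i /\ S u <= \sum_(j | j != i) P (l i) j + rho (l i).
Proof.
move=> E; have iG : i \in G u by rewrite E set11.
have := others iG; have := ab i; move: iG; rewrite inE => /eqP ->.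
move: (S u) (\sum_(_ | _) P u _) (\sum_(_ in _ | _) _) (a i) (rho u) => *; lia.
Qed.

Lemma level_two_colors u i1 i2 : i1 != i2 -> G u = [set i1; i2] ->
  (exists i, 2 * S u + q <= \sum_(j | j != i) P (l i) j + rho (l i)) /\
  let n := a i1 + a i2 in let w := q + S u in 
  [/\ 3 * w <= n, 2 <= n, w = 1 -> 4 <= n & 1 < w -> 3 * w + 2 <= n].
Proof.
move=> i12 E; have i1G : i1 \in G u by rewrite E set21.
have i2G : i2 \in G u by rewrite E set22.
have o1 := others i1G; have o2 := others i2G.
have e1 : \sum_(j in G u | j != i1) P u j = P u i2.
  rewrite (big_pred1 i2) // => j; rewrite E !inE.
  by case: (eqVneq j i1) => [->|] /=; rewrite ?andbT // (negbTE i12).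
have e2 : \sum_(j in G u | j != i2) P u j = P u i1.
  rewrite (big_pred1 i1) // => j; rewrite E !inE.
  by case: (eqVneq j i2) => [->|] /=; rewrite ?andbT ?orbF ?andbF // eq_sym (negbTE i12).
rewrite e1 in o1; rewrite e2 in o2.
have l1 : l i1 = u by apply/eqP; rewrite inE in i1G.
have l2 : l i2 = u by apply/eqP; rewrite inE in i2G.
have := exceptions u (G u); rewrite E !big_setU1 ?inE //= !big_set1.
have := ab i1; have := ab i2; have := m0 i1; have := m0 i2.
have x1 : exists i, \sum_(j | j != i1) P u j + rho u <= \sum_(j | j != i) P (l i) j + rho (l i).
  by exists i1; rewrite l1.
have x2 : exists i, \sum_(j | j != i2) P u j + rho u <= \sum_(j | j != i) P (l i) j + rho (l i).
  by exists i2; rewrite l2.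
rewrite !aE l1 l2.
move: (\sum_(_ | _ != i1) _) (\sum_(_ | _ != i2) _) o1 o2 x1 x2 => s1 s2 o1 o2 x1 x2 p1 p2 b2 b1 bb.
have [h1 h2] : (q + S u <= P u i1 + rho u \/ q + S u <= P u i2 + rho u) /\
  [/\ 3 * (q + S u) <= m u i1 + m u i2 + P u i1 + P u i2, 2 <= m u i1 + m u i2 + P u i1 + P u i2,
      q + S u = 1 -> 4 <= m u i1 + m u i2 + P u i1 + P u i2
    & 1 < (q + S u) -> 3 * (q + S u) + 2 <= m u i1 + m u i2 + P u i1 + P u i2].
  move: bb o1 o2 b1 b2 p1 p2.
  move: (S u) (rho u) (m u i1) (m u i2) (P u i1) (P u i2) => S0 r m1 m2 P1 P2; clear => bb *.
  apply: two_color_growth; lia.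
split.
  case: h1 => h1; [case: x2 => i xi | case: x1 => i xi]; exists i; apply: leq_trans xi.
    by move: o2 h1; clear; lia.
  by move: o1 h1; clear; lia.
by rewrite (_ : P u i1 + m u i1 + _ = m u i1 + m u i2 + P u i1 + P u i2) // ; clear; lia.
Qed.

(** In a layer that is the level of three or more colours, summing [ab] over the
    colours requires more exceptional edges than [exceptions] admits, unless
    there are exactly three, [q = 0] and no level comes earlier. *)
Lemma level_three_colors u : 2 < #|G u| -> #|G u| = 3 /\ q + S u = 0.
Proof.
move=> G3; set w := q + S u; set T := \sum_(i in G u) m u i.
set p := \sum_(i in G u) P u i.
have lu i : i \in G u -> l i = u by rewrite inE => /eqP.
have big i : i \in G u -> w + rho u + p <= m u i + 2 * P u i.
  move=> iG; have := ab i; have := others iG; rewrite aE lu // /w /p (bigD1 i iG) /=.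
  by move: (\sum_(_ | _) _) (\sum_(_ in _ | _) _) => x y; clear; lia.
have rest i : i \in G u -> #|G u|.-1 * (w + rho u) <= T - m u i.
  move=> iG; have -> : T = m u i + \sum_(j in G u | j != i) m u j by rewrite /T (bigD1 i iG).
  rewrite addKn.
  have : \sum_(j in G u | j != i) (w + rho u + p) <= \sum_(j in G u | j != i) (m u j + 2 * P u j).
    by apply: leq_sum => j /andP[jG _]; apply: big.
  have e2 : \sum_(j in G u | j != i) 2 * P u j = 2 * \sum_(j in G u | j != i) P u j.
    by rewrite big_distrr.
  rewrite [X in _ <= X]big_split /= e2 sum_nat_cond_const.
  rewrite (_ : #|_| = #|G u|.-1); last first.
    by rewrite (cardsD1 i (G u)) iG /=; apply: eq_card => j; rewrite !inE andbC.
  have : p = P u i + \sum_(j in G u | j != i) P u j by rewrite /p (bigD1 i iG).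
  move: (\sum_(_ in _ | _) P _ _) (\sum_(_ in _ | _) m _ _) (w + rho u) => x y z pE.
  have k2 : 2 <= #|G u|.-1 by move: G3; move: #|G u|; clear; lia.
  have : 2 * x <= #|G u|.-1 * p by apply: leq_mul; rewrite // pE leq_addl.
  by rewrite mulnDr; move: (_ * p) (_ * z); clear; lia.
have T0 : 0 < T.
  have [i iG] : exists i, i \in G u by apply/card_gt0P; apply: leq_trans G3.
  by rewrite /T (bigD1 i iG) /= addn_gt0 -{1}(lu i iG) m0.
have : #|G u|.-1 * (w + rho u) * T <= 2 * rho u * T.
  apply: leq_trans (exceptions u (G u)); rewrite mulnC /T big_distrl /=.
  by apply: leq_sum => i iG; rewrite leq_mul2l rest // orbT.
rewrite leq_pmul2r // => h.
have r0 : 0 < rho u.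
  rewrite lt0n; apply/eqP => r0; have := exceptions u (G u); rewrite r0 muln0 mul0n leqn0.
  have /card_gt1P[i [j [iG jG ij]]] : 1 < #|G u| by apply: ltnW.
  rewrite (bigD1 i iG) /= addn_eq0 muln_eq0 => /andP[/orP[|] + _].
    by have := m0 i; rewrite (lu i iG) lt0n => /negbTE->.
  rewrite (bigD1 i iG) /= addKn (bigD1 j) /=; last by rewrite eq_sym ij andbT.
  by rewrite addn_eq0; have := m0 j; rewrite (lu j jG) lt0n => /negbTE->.
by move: h r0 G3; rewrite /w; move: #|G u| (rho u) (q + S u); clear; nia.
Qed.

Lemma growth u : g #|J u| <= S u.
Proof.
elim: u => [|u IH].
  have -> : J 0 = set0 by apply/setP => i; rewrite !inE.
  by rewrite cards0 g0.
rewrite cJS SS.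
have J0 : #|J u| = 0 -> S u = 0.
  by move/eqP; rewrite cards_eq0 /S => /eqP ->; rewrite big_set0.
case: (ltnP 2 #|G u|) => [G3|G2].
  have [E w0] := level_three_colors G3.
  have cJ0 : #|J u| = 0.
    apply/eqP; rewrite cards_eq0; apply/set0Pn => -[i iJ].
    by move: w0 (aq i); rewrite /S (bigD1 i iJ) /=; lia.
  rewrite cJ0 add0n E; apply: leq_trans (g3 _) _; first by move: w0; clear; lia.
  apply: leq_trans (leq_addl _ _); rewrite -{1}E -sum1_card; apply: leq_sum => i _.
  exact: leq_ltn_trans (aq i).
case: (posnP #|G u|) => [G0|Gp].
  by rewrite G0 addn0; apply: leq_trans IH (leq_addr _ _).
have [G1|{}G2] : #|G u| = 1 \/ #|G u| = 2 by move: G2 Gp; move: #|G u|; clear; lia.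
  have /cards1P[i E] : #|G u| == 1 by rewrite G1.
  rewrite E cards1 big_set1 addn1; have [h _] := level_one_color E; have := aq i.
  case: (posnP #|J u|) => [cJ0|Jp]; last by have := gS Jp; lia.
  by rewrite cJ0; lia.
have /cards2P[i1 [i2 [i12 E]]] : #|G u| == 2 by rewrite G2.
rewrite G2 E big_setU1 ?inE // big_set1 addn2.
have [_ /= [h1 h2 h3 h4]] := level_two_colors i12 E.
case: (posnP #|J u|) => [cJ0|Jp]; last first.
  have := gS Jp; have := gS (ltn0Sn #|J u|); move: IH h1.
  by move: (a i1 + a i2) (S u) (g _) (g _) (g _); clear; lia.
rewrite cJ0; rewrite J0 // addn0 in h1 h2 h3 h4 *.
by apply: leq_trans g2 _; case: q h2 h3 h4 => [|[|q']] /= h2 h3 h4; [|exact: h3|exact: h4].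
Qed.

(** A colour with its level in the last layer competes with all the other
    colours, whose total [growth] bounds from below. *)
Lemma growth_last : 2 < #|C| -> 3 < #|C| \/ 0 < q ->
  exists i, g #|C|.-1 <= \sum_(j | j != i) P (l i) j + rho (l i).
Proof.
move=> C3 big; have [i0 lE] := eq_bigmax l (ltnW (ltnW C3)).
set u := \max_i l i in lE.
have JT : J u.+1 = setT.
  by apply/setP => i; rewrite !inE ltnS; apply: leq_bigmax.
have iG : i0 \in G u by rewrite inE -lE.
have cT : #|J u| + #|G u| = #|C| by rewrite -cJS JT cardsT.
have IH := growth u.
case: (ltnP 2 #|G u|) => [G3|G2].
  have [E w0] := level_three_colors G3.
  have /card_gt0P[i iJ] : 0 < #|J u|.
    by move: cT big w0; rewrite E; move: #|J u| #|C| (S u); clear; lia.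
  by move: w0 (aq i); rewrite /S (bigD1 i iJ) /=; lia.
have Gp : 0 < #|G u| by apply/card_gt0P; exists i0.
have [G1|{}G2] : #|G u| = 1 \/ #|G u| = 2 by move: G2 Gp; move: #|G u|; clear; lia.
  have /cards1P[i E] : #|G u| == 1 by rewrite G1.
  exists i; have [_ h] := level_one_color E; apply: leq_trans h.
  by rewrite -cT G1 addn1.
have /cards2P[i1 [i2 [i12 E]]] : #|G u| == 2 by rewrite G2.
have [[i h] _] := level_two_colors i12 E; exists i; apply: leq_trans h.
have Jp : 0 < #|J u| by move: cT C3; rewrite G2; move: #|J u| #|C|; clear; lia.
rewrite -cT G2 addn2 /=; apply: leq_trans (gS Jp) _.
by rewrite leq_add2r leq_mul2l IH.
Qed.

End Growth.

(** * The lower bound on s *)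

Section Bound.
Variables (V C : finType) (c : {ffun {set V} -> C}).
Variables (X : {set V}) (b : V -> nat) (mn : V -> C) (rho : nat -> nat).

Definition layer u i := #|[set y in own X mn i | b y == u]|.

(** An edge of the layer between two vertices with different main colours is
    exceptional at one end at least, so counting ordered pairs gives at most
    twice the number of exceptions. *)
Lemma layer_exceptions u (G : {set C}) :
    layered c X b mn rho ->
  \sum_(i in G) layer u i * (\sum_(j in G) layer u j - layer u i)
    <= 2 * rho u * \sum_(i in G) layer u i.
Proof.
case=> _ _ h3 _; pose m := layer u; rewrite -/m.
pose B := [set x in X | (b x == u) && (mn x \in G)].
have mE i : i \in G -> m i = #|[set x in B | mn x == i]|.
  move=> iG; apply: eq_card => x; rewrite !inE.
  by case: (eqVneq (mn x) i) => [->|_]; rewrite ?iG ?andbT ?andbF.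
have BE : \sum_(i in G) m i = #|B|.
  rewrite -[#|B|]sum1_card (partition_big mn (mem G)) /=; last first.
    by move=> x; rewrite inE => /and3P[].
  by apply: eq_bigr => i iG; rewrite mE // -sum1_card; apply: eq_bigl => x; rewrite inE.
have LE : \sum_(i in G) m i * (#|B| - m i) = \sum_(x in B) \sum_(y in B) (mn y != mn x).
  rewrite [RHS](partition_big mn (mem G)) /=; last by move=> x; rewrite inE => /and3P[].
  apply: eq_bigr => i iG; rewrite mE // -[X in X * _]sum1_card big_distrl /=.
  rewrite [RHS](eq_bigl (fun x => x \in [set x in B | mn x == i])); last by move=> x; rewrite [RHS]inE.
  apply: eq_bigr => x; rewrite inE mul1n => /andP[_ /eqP xi].
  rewrite -big_mkcondr /= sum1dep_card -(cardsID [set x | mn x == i] B).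
  rewrite (_ : B :&: _ = [set x in B | mn x == i]); last by apply/setP => y; rewrite !inE.
  by rewrite addKn; apply: eq_card => y; rewrite !inE xi andbC.
rewrite BE LE.
pose E x y := (y != x) && (c [set x; y] != mn x).
have D : \sum_(x in B) \sum_(y in B) E x y <= rho u * #|B|.
  rewrite mulnC -sum_nat_const; apply: leq_sum => x.
  rewrite inE => /and3P[xX /eqP xu _]; rewrite -xu -h3 // -sum1dep_card.
  rewrite big_mkcond [X in _ <= X]big_mkcond; apply: leq_sum => y _; rewrite /E inE xu.
  by case: (y \in X); case: (b y == u); case: (_ \in G); case: (y != x); case: (_ != _).
rewrite -mulnA mul2n -addnn; apply: leq_trans (leq_add D D).
rewrite [X in _ <= _ + X]exchange_big -big_split; apply: leq_sum => x xB.
rewrite -big_split; apply: leq_sum => y yB; rewrite /E /=.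
case: (eqVneq (mn y) (mn x)) => //= mxy.
have -> : y != x by apply: contra_neq mxy => ->.
have -> : x != y by apply: contra_neq mxy => ->.
rewrite /= [[set y; x]]setUC; case: eqP => //= ->.
by rewrite eq_sym mxy.
Qed.

Lemma reach_split x : reach X b mn x =
  #|[set y in own X mn (mn x) | b y < b x]| + layer (b x) (mn x).
Proof.
rewrite /reach /layer -cardsUI [_ :&: _](_ : _ = set0) ?cards0 ?addn0.
  by apply: eq_card => y; rewrite !inE leq_eqVlt orbC -andb_orr.
by apply/setP => y; rewrite !inE; case: ltngtP; rewrite ?andbF.
Qed.

Lemma before_split x : before X b mn rho x =
  \sum_(j | j != mn x) #|[set y in own X mn j | b y < b x]| + rho (b x).
Proof.
rewrite /before -sum1_card (partition_big mn (fun j => j != mn x)) /=; last first.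
  by move=> y; rewrite inE => /and3P[].
congr (_ + _); apply: eq_bigr => j jx; rewrite sum1dep_card; apply: eq_card => y.
rewrite !inE; case: (eqVneq (mn y) j) => [->|_]; last by rewrite !andbF.
by rewrite jx /= !andbT.
Qed.

End Bound.

Lemma polychromatic_bound (V C : finType) (s q : nat) (g : nat -> nat)
    (c : {ffun {set V} -> C}) :
    polychromatic s c -> #|V| = s + q -> 3 < s -> 4 * q <= s.+1 ->
    2 < #|C| -> 3 < #|C| \/ 0 < q ->
    g 0 = 0 -> g 1 <= q.+1 -> (forall j, 0 < j -> g j.+1 <= 2 * g j + q) ->
    g 2 <= match q with 0 => 2 | 1 => 4 | _ => 3 * q + 2 end ->
    (q = 0 -> g 3 <= 3) ->
  2 * g #|C|.-1 < s.
Proof.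
move=> cP Vs s4 sq C3 Cq g0 g1 gS g2 g3.
have [i0 _] : exists i : C, i \in C by apply/card_gt0P; apply: leq_trans C3.
have lay0 : layered c set0 (fun=> 0) (fun=> i0) (fun=> 0).
  by split=> [x y|x y|x|x y]; rewrite inE.
have b0 : {in (set0 : {set V}), forall x, (fun=> 0) x < 1} by move=> x; rewrite inE.
have [c' [X [b [mn [rho [c'P lay term]]]]]] := exists_layered cP C3 s4 lay0 b0.
have lev i : exists x, [/\ x \in own X mn i, q + before X b mn rho x <= reach X b mn x,
    q < reach X b mn x & (before X b mn rho x).*2 < s].
  case: (level_or_small c'P s4 Vs lay i term) => [[x xi [h1 h2 h3]]|[Xq [d bal]]]; first by exists x.
  exfalso; apply: (no_small_balanced c'P s4 Vs lay Xq bal sq).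
  by case: Cq => h; [left | case: (leqP #|C| 3) => C3'; [right | left]] => //; split=> //; lia.
have [x xP] := fin_all_exists lev.
have mx i : mn (x i) = i by have [/ownP[]] := xP i.
have h1 i : reach X b mn (x i) =
    #|[set y in own X mn i | b y < b (x i)]| + layer X b mn (b (x i)) i.
  by rewrite reach_split mx.
have h2 i u v : u < v ->
    #|[set y in own X mn i | b y < u]| + layer X b mn u i <= #|[set y in own X mn i | b y < v]|.
  move=> uv; rewrite /layer -cardsUI [_ :&: _](_ : _ = set0) ?cards0 ?addn0.
    apply/subset_leq_card/subsetP => y; rewrite !inE => /orP[]/andP[-> /=].
      by move/ltn_trans; apply.
    by move/eqP->.
  by apply/setP => y; rewrite !inE; case: ltngtP; rewrite ?andbF.
have h3 i : q < reach X b mn (x i) by have [] := xP i.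
have h4 i : 0 < layer X b mn (b (x i)) i.
  by apply/card_gt0P; exists (x i); rewrite inE eqxx andbT; have [] := xP i.
have h5 i : before X b mn rho (x i) =
    \sum_(j | j != i) #|[set y in own X mn j | b y < b (x i)]| + rho (b (x i)).
  by rewrite before_split mx.
have h6 i : q + (\sum_(j | j != i) #|[set y in own X mn j | b y < b (x i)]| + rho (b (x i)))
    <= reach X b mn (x i) by rewrite -h5; have [] := xP i.
have [i] := growth_last h1 h2 h3 h4 h6 (fun u G => layer_exceptions u G lay) g0 g1 gS g2 g3 C3 Cq.
rewrite -h5 => gi; have [_ _ _ lt] := xP i; apply: leq_ltn_trans lt.
by rewrite -mul2n leq_mul2l.
Qed.

(** * Graphs without long cycles *)

Section Blocking.
Variables (V : finType) (e : rel V) (s q : nat).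
Hypotheses (eC : symmetric e) (Vs : #|V| = s + q).

(** [A] is independent and all its neighbours lie in [B]. A cycle of length [s]
    meets [A] in at least [#|A| - q] vertices, whose successors are distinct
    vertices of [B]. In the case of equality the predecessors exhaust [B] as
    well, so the cycle alternates between [A] and [B], and it has only
    [2 * #|B|] vertices. *)
Lemma blocking_set (A B : {set V}) p :
    (forall x y, x \in A -> e x y -> y \in B) ->
    #|B| + q < #|A| \/ [/\ #|B| + q <= #|A|, 0 < #|B| & 2 * #|B| < s] ->
  size p = s -> uniq p -> ~~ cycle e p.
Proof.
move=> AB big sp Up; apply/negP => pc.
pose P := [set x in p]; have cP : #|P| = s by rewrite cardsE (card_uniqP Up).
have AP : #|A| <= #|A :&: P| + q.
  have := cardsC P; have := cardsID P A; have : #|A :\: P| <= #|~: P|.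
    by apply: subset_leq_card; rewrite setDE subsetIr.
  by rewrite Vs cP; move: #|A| #|_ :&: _| #|_ :\: _| #|~: _|; clear; lia.
have nB x : x \in A :&: P -> next p x \in B.
  by rewrite !inE => /andP[xA xp]; apply: AB xA _; apply: next_cycle.
have vB x : x \in A :&: P -> prev p x \in B.
  by rewrite !inE => /andP[xA xp]; apply: AB xA _; rewrite eC; apply: prev_cycle.
have cn : #|next p @: (A :&: P)| = #|A :&: P|.
  by rewrite card_imset //; apply: can_inj (prev_next Up).
have cv : #|prev p @: (A :&: P)| = #|A :&: P|.
  by rewrite card_imset //; apply: can_inj (next_prev Up).
have nS : next p @: (A :&: P) \subset B by apply/subsetP => _ /imsetP[x /nB + ->].
have vS : prev p @: (A :&: P) \subset B by apply/subsetP => _ /imsetP[x /vB + ->].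
have ApB : #|A :&: P| <= #|B| by rewrite -cn; apply: subset_leq_card.
case: big => [|[b1 b2 b3]]; first by lia.
have vE : prev p @: (A :&: P) = B.
  by apply/eqP; rewrite eqEcard vS cv; lia.
pose Q := (A :&: P) :|: B.
have Qn x : x \in Q -> next p x \in Q.
  case/setUP=> [xA|]; first by rewrite !inE nB ?orbT.
  by rewrite -{1}vE => /imsetP[y yA ->]; rewrite next_prev // inE yA.
have [x xB] : exists x, x \in B by apply/card_gt0P.
have xp : x \in p.
  by move: xB; rewrite -vE => /imsetP[y]; rewrite !inE => /andP[_ yp] ->; rewrite mem_prev.
pose e' a b := (a \in Q) ==> (b \in Q).
have e'T : transitive e'.
  by move=> b a d; rewrite /e'; case: (a \in Q) => //= -> /=.
have pQ : {subset p <= Q}.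
  have pc' : cycle e' p by apply: cycle_from_next => // y _; apply/implyP/Qn.
  move=> y yp; case: (rot_to xp) => n r rE.
  have : cycle e' (x :: r) by rewrite -rE rot_cycle.
  rewrite /= rcons_path => /andP[/(order_path_min e'T)/allP h _].
  have xQ : x \in Q by rewrite inE xB orbT.
  have : y \in x :: r by rewrite -rE mem_rot.
  by rewrite inE => /orP[/eqP->//|/h]; rewrite /e' xQ.
have : s <= #|Q|.
  by rewrite -cP; apply/subset_leq_card/subsetP => y; rewrite inE => /pQ.
have : #|Q| <= #|A :&: P| + #|B| by apply: leq_card_setU.
by lia.
Qed.

Lemma cycle_two_neighbors p x : cycle e p -> uniq p -> 2 < size p -> x \in p ->
  exists y z, [/\ y != z, e x y & e x z].
Proof.
move=> pc Up p3 xp; case: (rot_to xp) => n r rE.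
have rc : cycle e (x :: r) by rewrite -rE rot_cycle.
have Ur : uniq (x :: r) by rewrite -rE rot_uniq.
have r3 : 2 < size (x :: r) by rewrite -rE size_rot.
case: r rc Ur r3 {rE} => [|y [|w r]] //= /andP[xy]; rewrite rcons_path => /andP[_ h] U _.
exists y, (last w r); split=> //; last by rewrite eC; case/andP: h.
by case/and3P: U => _ yr _; apply: contraNneq yr => ->; rewrite mem_last.
Qed.

End Blocking.

(** * Forcing cycles and polychromatic colourings *)

Lemma forces_cycleP t s n : forces_cycle t s n <->
  forall c : {ffun {set 'I_n} -> 'I_t}, ~~ polychromatic s c.
Proof.
split=> [F c | F c].
  have [p [sp /andP[pc Up] miss]] := F c.
  have [i ni] : exists i, i \notin c @: cycle_edges p.
    by apply/existsP; rewrite -negb_forall; apply: contra miss => /forallP h; apply/eqP/setP => i; rewrite h inE.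
  apply/negP => /polychromaticP/(_ i p sp Up)/negP; apply.
  apply: cycle_from_next => // x xp; have := next_cycle pc xp; rewrite /complete_graph /avoid /= => -> /=.
  by apply: contra ni => /eqP <-; apply: imset_f; apply: imset_f.
have := F [ffun e => c e]; rewrite /polychromatic negb_forall => /existsP[i].
rewrite negb_forall => /existsP[[p /= sp]]; rewrite negb_imply negbK => /andP[Up pc].
exists p; split; first exact/eqP.
  by rewrite /ucycle Up andbT; apply: sub_cycle pc => x y /andP[].
apply/eqP => E; have : i \in c @: cycle_edges p by rewrite E inE.
case/imsetP => e /imsetP[x xp ->] iE; have := next_cycle pc xp.
by rewrite /avoid /= ffunE iE eqxx andbF.
Qed.

(** Colourings restrict to smaller complete graphs, which is why only the number
    of vertices just below PR has to be refuted. *)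
Lemma forces_cycle_leq t s m n : m <= n -> forces_cycle t s m -> forces_cycle t s n.
Proof.
move=> mn /forces_cycleP F; apply/forces_cycleP => c; apply/negP => /polychromaticP cP.
have fI : injective (widen_ord mn) by move=> x y /(congr1 val) /= /val_inj.
apply/negP: (F [ffun e : {set 'I_m} => c (widen_ord mn @: e)]); rewrite negbK.
apply/polychromaticP => i p sp Up; apply: contra (cP i (map (widen_ord mn) p) _ _).
- rewrite cycle_map; apply: sub_cycle => x y /=; rewrite /avoid /= ffunE.
  by rewrite imsetU1 imset_set1 (inj_eq fI).
- by rewrite size_map.
- by rewrite map_inj_uniq.
Qed.

(** * Ordered colourings *)

Lemma pendant_set (V : finType) (e : rel V) s q (D : {set V}) p :
    symmetric e -> #|V| = s + q -> q < #|D| -> 2 < s ->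
    (forall x y z, x \in D -> e x y -> e x z -> y = z) ->
  size p = s -> uniq p -> ~~ cycle e p.
Proof.
move=> eC Vs Dq s3 De sp Up; apply/negP => pc.
have [x xD xp] : exists2 x, x \in D & x \in p.
  apply/exists_inP; apply: contraLR Dq; rewrite negb_exists_in -leqNgt => /forall_inP nD.
  have cP : #|[set x in p]| = s by rewrite cardsE (card_uniqP Up).
  have : #|D| <= #|~: [set x in p]|.
    by apply/subset_leq_card/subsetP => x /nD; rewrite !inE.
  by have := cardsC [set x in p]; rewrite cP Vs; move: #|~: _| #|D|; clear; lia.
have p3 : 2 < size p by rewrite sp.
have [y [z [yz xy xz]]] := cycle_two_neighbors eC pc Up p3 xp.
by rewrite (De x y z xD xy xz) eqxx in yz.
Qed.

Lemma card_ord_lt n m : m <= n -> #|[set x : 'I_n | x < m]| = m.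
Proof.
move=> mn; rewrite -sum1dep_card -(big_ord_widen n (fun=> 1) mn).
by rewrite sum1_card card_ord.
Qed.

Section Ordered.
Variables (n t' : nat) (h : nat -> nat -> nat).

(** The colour of the edge [{x, y}] with [x < y] is [h x y]: on a pair, the sum
    minus the maximum is the smaller element. *)
Definition edge_color : {ffun {set 'I_n} -> 'I_t'.+1} :=
  [ffun e : {set 'I_n} => inord (h (\sum_(x in e) x - \max_(x in e) x) (\max_(x in e) x))].

Lemma avoid_edge_color (i : 'I_t'.+1) (x y : 'I_n) :
    (forall a b, h a b <= t') -> avoid edge_color i x y ->
  x < y /\ h x y != i \/ y < x /\ h y x != i.
Proof.
move=> ht; wlog xy : x y / x < y => [H|].
  case: (ltngtP x y) => [xy|yx|/val_inj->]; last by rewrite /avoid /= eqxx.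
    by move=> /(H x y xy)[[_ ?]|[yx _]]; [left | move: (ltn_trans xy yx); rewrite ltnn].
  rewrite avoidC => /(H y x yx)[[_ ?]|[xy _]]; first by right.
  by move: (ltn_trans xy yx); rewrite ltnn.
have xNy : x \notin [set y] by rewrite inE; apply/eqP => E; rewrite E ltnn in xy.
rewrite /avoid /= ffunE !big_setU1 //= !big_set1 (maxn_idPr (ltnW xy)) addnK.
case/andP=> _ hi; left; split=> //; apply: contra hi => /eqP hi.
by apply/eqP/val_inj; rewrite /= inordK ?ltnS // hi.
Qed.

Variable M : nat -> nat.
Hypotheses (M0 : M 0 = 0) (M_homo : {homo M : i j / i <= j}).

Definition level x := count (fun j => M j <= x) (iota 1 t').

Lemma level_le x : level x <= t'.
Proof. by rewrite -[X in _ <= X](size_iota 1); apply: count_size. Qed.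

Lemma level_eq i x : i <= t' -> M i <= x -> (i < t' -> x < M i.+1) -> level x = i.
Proof.
move=> it Mix xM; rewrite /level -(subnKC it) iotaD count_cat.
rewrite (eq_in_count (a2 := predT)); last first.
  by move=> j; rewrite mem_iota /= => /andP[_ ji]; rewrite (leq_trans _ Mix) // M_homo //; lia.
rewrite count_predT size_iota (eq_in_count (a2 := pred0)) ?count_pred0 ?addn0 //.
move=> j; rewrite mem_iota /= => /andP[ij jt]; apply/negbTE; rewrite -ltnNge.
by apply: leq_trans (xM _) _; [lia | apply: M_homo; lia].
Qed.

(** Only the first [z] vertices may follow another pattern; they all come before
    level [i]. The vertices of level [i] and those before it are the two sets of
    [blocking_set], the bound of the last level being the number of vertices. *)
Lemma level_blocks (z s q : nat) (i : 'I_t'.+1) p :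
    (forall a b, h a b <= t') -> (forall a b, z <= b -> h a b = level a) ->
    n = s + q -> z <= M i -> 2 * M t' < s -> 
    (i < t' -> 2 * M i + q <= M i.+1 /\ (0 < M i \/ 2 * M i + q < M i.+1)) ->
  size p = s -> uniq p -> ~~ cycle (avoid edge_color i) p.
Proof.
move=> ht hz nE zM Ms Mi; have it : i <= t' by rewrite -ltnS.
have MiM : M i <= M t' by apply: M_homo.
pose B := [set x : 'I_n | x < M i].
pose u := if i < t' then minn (M i.+1) n else n.
have uM : i < t' -> M i.+1 <= n.
  by move=> lt; have := M_homo lt; rewrite nE; lia.
pose A := [set x : 'I_n | x < u] :\: B.
have cB : #|B| = M i by rewrite card_ord_lt // nE; lia.
have cA : #|A| = u - M i.
  rewrite cardsD (setIidPr _).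
    by rewrite cB card_ord_lt // /u; case: ifP => // _; apply: geq_minr.
  apply/subsetP => x; rewrite !inE => xM; rewrite /u; case: ifP => // lt.
  by rewrite leq_min ltn_ord andbT; apply: leq_trans xM _; apply: M_homo.
apply: (@blocking_set _ _ s q (@avoidC _ _ _ i) _ A B).
- by rewrite card_ord.
- move=> x y; rewrite !inE -leqNgt => /andP[Mx xu] xy; rewrite ltnNge; apply/negP => My.
  have lv (w : nat) : M i <= w -> w <= x -> level w = i.
    move=> Mw wx; apply: level_eq => // lt; apply: leq_ltn_trans wx _.
    by move: xu; rewrite /u lt leq_min => /andP[].
  case: (avoid_edge_color ht xy) => -[lt] /eqP; apply.
    by rewrite hz ?lv // (leq_trans zM).
  by rewrite hz ?lv ?(ltnW lt) // (leq_trans zM).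
rewrite cA cB /u; case: ifP Mi => [lt|ge].
  by case=> // h1 h2; rewrite (minn_idPl (uM lt)); case: h2 => h2; [right; split | left]; lia.
have -> : nat_of_ord i = t' by lia.
by move=> _; left; lia.
Qed.

End Ordered.

(** The number of vertices of levels below [j] in the extremal colourings. For [q]
    at least 2 this is the solution of [M j.+1 = 2 * M j + q], [M 1 = q.+1]; the
    patterns on the first three vertices ([q = 0]) and on the first four
    ([q = 1]) save one vertex at [j = 3] and [j = 2] respectively. *)
Definition threshold q j :=
  match q, j with
  | _, 0 => 0
  | 0, 1 => 1
  | 0, 2 => 2
  | 0, j.+3 => 3 * 2 ^ j
  | 1, 1 => 2
  | 1, j.+2 => 5 * 2 ^ j - 1
  | _, j.+1 => (2 ^ j.+1 - 1) * q + 2 ^ j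
  end.

Lemma threshold0 q : threshold q 0 = 0. Proof. by case: q => [|[|q]]. Qed.

Lemma threshold1 q : threshold q 1 = q.+1.
Proof. by case: q => [|[|q]] //=; rewrite expn1 expn0 mul1n addn1. Qed.

Lemma thresholdS_eq q j : (if q is 0 then 2 else if q is 1 then 1 else 0) < j ->
  threshold q j.+1 = 2 * threshold q j + q.
Proof.
have pos k : 0 < 2 ^ k by rewrite expn_gt0.
case: q j => [|[|q]] [|[|[|j]]] //= _; rewrite ?expnS ?expn0 //; lia.
Qed.

Lemma thresholdS q j : 0 < j -> threshold q j.+1 <= 2 * threshold q j + q.
Proof.
by case: q j => [|[|q]] [|[|[|j]]] // _; rewrite thresholdS_eq.
Qed.

Lemma threshold2 q :
  threshold q 2 = match q with 0 => 2 | 1 => 4 | _ => 3 * q + 2 end.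
Proof. by case: q => [|[|q]] //=; rewrite !expnS expn0; lia. Qed.

Lemma threshold_homo q : {homo threshold q : i j / i <= j}.
Proof.
apply: homo_leq => // [y x z|j]; first exact: leq_trans.
case: j => [|j]; first by rewrite threshold0.
case: (ltnP (if q is 0 then 2 else if q is 1 then 1 else 0) j.+1) => h.
  by rewrite (thresholdS_eq h); move: (threshold q j.+1); clear; lia.
by case: q h => [|[|q]] //=; case: j => [|[|j]].
Qed.

(** For [q = 0] the first three vertices form a triangle with cyclically
    assigned colours 0, 1, 2, and for [q = 1], among the first four vertices,
    the edges 03, 12, 23 have colour 1 and the other three colour 0. This leaves every one of
    [q.+1] vertices with a single neighbour in the graph avoiding an early
    colour, which [pendant_set] excludes from all long cycles. *)
Lemma polychromatic_construction t s q : 2 < t -> 2 < s ->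
  (3 < t \/ 0 < q -> 2 * threshold q t.-1 < s) ->
  ~ forces_cycle t s (s + q).
Proof.
case: t => // t' t3 s3 ts /forces_cycleP F.
pose M := threshold q.
pose lev := level t' M.
have lv : forall i x, i <= t' -> M i <= x -> (i < t' -> x < M i.+1) -> lev x = i.
  by move=> i x; apply: (level_eq (threshold0 q) (@threshold_homo q)).
(* The levels of the smaller end, changed on the first few vertices. *)
pose h a b := match q with
  | 0 => if (a == 0) && (b == 2) then 2 else lev a
  | 1 => if (b < 4) && (a + b == 3) then 1 else lev a
  | _ => lev a end.
have ht a b : h a b <= t'.
  by have := level_le t' M a; rewrite /h -/lev; case: (q) => [|[|q']] //=; case: ifP => //; lia.
apply/negP: (F (edge_color (s + q) t' h)); rewrite negbK; apply/polychromaticP => i p sp Up.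
pose z := match q with 0 => 3 | 1 => 4 | _ => 0 end.
have hz a b : z <= b -> h a b = lev a.
  rewrite /z /h; case: (q) => [|[|q']] // zb; rewrite ifF //; lia.
have cV : #|'I_(s + q)| = s + q by rewrite card_ord.
case: (leqP z (M i)) => zM.
  have tq : 3 < t'.+1 \/ 0 < q.
    move: zM; rewrite /z /M; case: (q) => [|q'] zM; last by right.
    left; rewrite ltnNge; apply/negP => t2.
    have i2 : i <= 2 by have := ltn_ord i; lia.
    by have := threshold_homo 0 i2; move: zM; rewrite [threshold 0 2]/=; clear; lia.
  apply: (level_blocks (threshold0 q) (@threshold_homo q) ht hz (erefl _) zM (ts tq) _ sp Up).
  move=> it; case: (posnP i) zM => [-> |i0] zM.
    by rewrite threshold0 threshold1 muln0; split; [lia | right; lia].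
  have Mi0 : 0 < threshold q i by apply: leq_trans (threshold_homo q i0); rewrite threshold1.
  rewrite thresholdS_eq; first by split=> //; left.
  rewrite ltnNge; apply/negP => iq; move: zM; rewrite /z /M.
  have := threshold_homo q iq; move: iq; case: (q) => [|[|q']] /=; lia.
pose one (D : {set 'I_(s + q)}) (tau : nat -> nat) := q < #|D| /\ forall x y : 'I_(s + q),
  x \in D -> avoid (edge_color (s + q) t' h) i x y -> val y = tau x.
(* An early level [i] lies within the pattern: [D] is the set of its vertices,
   and [tau] their only neighbours in the graph avoiding [i]. *)
suff [D [tau [Dq Dt]]] : exists D tau, one D tau.
  apply: (pendant_set (@avoidC _ _ _ i) cV Dq s3 _ sp Up) => x y w xD xy xw.
  by apply: val_inj; rewrite (Dt x y) // (Dt x w).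
have ord k : k < s -> exists x : 'I_(s + q), val x = k.
  by move=> ks; exists (Ordinal (ltn_addr q ks)).
have t2 : 1 < t' by lia.
have edge := @avoid_edge_color (s + q) t' h i _ _ ht.
have [q0|q1] : q = 0 \/ q = 1.
  by move: zM; rewrite /z; case: (q) => [|[|q']] //= _; [left | right].
- have M1 : M 1 = 1 by rewrite /M q0.
  have M2 : M 2 = 2 by rewrite /M q0.
  have M3 : M 3 = 3 by rewrite /M q0.
  have M0 : M 0 = 0 by rewrite /M threshold0.
  have lev0 : lev 0 = 0 by apply: lv; rewrite ?M0 ?M1.
  have lev1 : lev 1 = 1 by apply: lv; rewrite ?M1 ?M2 // ltnW.
  have lev2 : lev 2 = 2 by apply: lv; rewrite ?M2 ?M3.
  have hE a b : h a b = if (a == 0) && (b == 2) then 2 else lev a by rewrite /h q0.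
  have i3 : i < 3.
    rewrite ltnNge; apply/negP => i3; move: zM; rewrite /z q0 ltnNge -M3 => /negP; apply.
    exact: threshold_homo.
  have [x xi] := ord i (leq_trans i3 s3).
  exists [set x], (fun k => if k == 0 then 2 else k.-1).
  split=> [|x' y]; first by rewrite cards1 q0.
  rewrite inE => /eqP-> /edge; rewrite !hE /= xi.
  case: (i : nat) i3 => [|[|[|//]]] _ /=; rewrite ?lev1 ?lev2.
  + by case=> -[] // _; rewrite lev0; case: (eqVneq (y : nat) 2).
  + by case=> -[]; [rewrite eqxx | case: (y : nat)].
  + case=> -[]; first by rewrite eqxx.
    by case: (y : nat) => [|[|y']].
- have M1 : M 1 = 2 by rewrite /M q1.
  have M2 : M 2 = 4 by rewrite /M q1.
  have M0 : M 0 = 0 by rewrite /M threshold0.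
  have lev0 k : k < 2 -> lev k = 0 by move=> k2; apply: lv; rewrite ?M0 ?M1.
  have lev1 k : 1 < k < 4 -> lev k = 1.
    by case/andP=> k1 k4; apply: lv; rewrite ?M1 ?M2 // ltnW.
  have hE a b : h a b = if (b < 4) && (a + b == 3) then 1 else lev a by rewrite /h q1.
  have i2 : i < 2.
    rewrite ltnNge; apply/negP => i2; move: zM; rewrite /z q1 ltnNge -M2 => /negP; apply.
    exact: threshold_homo.
  have n4 : 3 < s + q by lia.
  pose D := [set x : 'I_(s + q) | (i.*2 <= x) && (x < i.*2.+2)].
  exists D, (fun k => if i == 0 :> nat then 3 - k else k - 2).
  split=> [|x y].
    have x1 : i.*2 < s + q by lia.
    have x2 : i.*2.+1 < s + q by lia.
    apply: leq_trans (_ : #|[set Ordinal x1; Ordinal x2]| <= _).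
      rewrite cards2 (_ : (Ordinal x1 != Ordinal x2) = true) ?q1 //.
      by rewrite -(inj_eq val_inj) /= neq_ltn ltnSn.
    by apply/subset_leq_card/subsetP => x; rewrite !inE => /orP[] /eqP -> /=; lia.
  rewrite inE => /andP[x1 x2] /edge; rewrite !hE /=.
  case: (i : nat) i2 x1 x2 => [|[|//]] _ /= x1 x2.
  + case=> -[xy]; first by case: ifP => [|_]; [lia | rewrite lev0].
    by rewrite lev0; last lia; case: ifP => // h1; lia.
  + case=> -[xy]; first by case: ifP => // _; rewrite lev1 // x1.
    case: ifP => // h1; case: (leqP 2 y) => y2; last by lia.
    by rewrite lev1 // y2; lia.
Qed.

(** * The values of PR *)

Import Order.TTheory GRing.Theory Num.Theory.

Lemma forces_cycle_threshold t s q : 2 < t -> 3 < s -> 4 * q <= s.+1 ->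
  3 < t \/ 0 < q -> s <= 2 * threshold q t.-1 -> forces_cycle t s (s + q).
Proof.
move=> t3 s4 sq tq st; apply/forces_cycleP => c; apply/negP => cP.
have cV : #|'I_(s + q)| = s + q by rewrite card_ord.
have cC : #|'I_t| = t by rewrite card_ord.
have := polychromatic_bound (g := threshold q) cP cV s4 sq; rewrite !cC => H.
suff : 2 * threshold q t.-1 < s by rewrite ltnNge st.
apply: (H t3 tq (threshold0 q)); rewrite ?threshold1 -?threshold2 //; last by move=> ->.
by move=> j; apply: thresholdS.
Qed.

Lemma is_PR_threshold t s q : 2 < t -> 3 < s -> 4 * q <= s.+1 ->
    3 < t \/ 0 < q -> s <= 2 * threshold q t.-1 ->
    (forall q', q = q'.+1 -> 3 < t \/ 0 < q' -> 2 * threshold q' t.-1 < s) ->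
  is_PR t s (s + q).
Proof.
move=> t3 s4 sq tq st ts; split; first exact: leq_addr.
  exact: forces_cycle_threshold.
case: q sq tq st ts => [|q] sq tq st ts m sm Fm; first by rewrite addn0.
rewrite leqNgt; apply/negP => ms; rewrite addnS ltnS in ms.
apply: (@polychromatic_construction t s q) => //; first exact: ltnW.
  exact: ts.
exact: forces_cycle_leq ms Fm.
Qed.

Theorem theorem2p7 (t s : nat) (ht : 3 <= t) (hs : 3 <= s) :
  [/\ 3 < s <= 3 * 2 ^ (t - 3) -> is_PR t s s,
      3 * 2 ^ (t - 3) + 1 <= s <= 5 * 2 ^ (t - 2) - 2 -> is_PR t s (s + 1),
      5 * 2 ^ (t - 2) - 1 <= s <= 5 * 2 ^ (t - 1) - 4 -> is_PR t s (s + 2)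
    & 5 * 2 ^ (t - 1) - 3 <= s ->
      is_PR t s (s + round ((s%:R - 2) / (2 ^+ t - 2))%R)].
Proof.
have [k tk] : exists k, t = k.+3 by exists (t - 3); lia.
subst t; rewrite (_ : k.+3 - 3 = k) 1?(_ : k.+3 - 2 = k.+1) 1?(_ : k.+3 - 1 = k.+2); try lia.
have k0 : 0 < 2 ^ k by rewrite expn_gt0.
have th0 j : threshold 0 j.+3 = 3 * 2 ^ j by [].
have th1 : threshold 1 k.+2 = 5 * 2 ^ k - 1 by [].
have thq q : 1 < q -> threshold q k.+2 = (2 ^ k.+2 - 1) * q + 2 ^ k.+1.
  by case: q => [|[|q]].
split.
- case/andP=> s4 su; rewrite -[X in is_PR _ _ X](addn0 s); apply: is_PR_threshold => //.
    by left; case: (k) su => [|k'] //; rewrite expn0; lia.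
  by case: (k) su => [|k'] /=; rewrite ?expnS; lia.
- case/andP=> sl su; apply: is_PR_threshold => //.
  + by lia.
  + by right.
  + by rewrite -pred_Sn th1; move: su; rewrite expnS; lia.
  + move=> [|//] _ []; last by rewrite ltnn.
    by case: (k) sl => [|k'] //= sl _; move: sl; rewrite expnS; lia.
- case/andP=> sl su; apply: is_PR_threshold => //.
  + by rewrite expnS in sl; lia.
  + by rewrite expnS in sl; lia.
  + by right.
  + by rewrite -pred_Sn thq //; move: su; rewrite !expnS; lia.
  + by move=> [|[|//]] // _ _; rewrite -pred_Sn th1; move: sl; rewrite expnS; lia.
- move=> sl; set x : rat := ((s%:R - 2) / (2 ^+ k.+3 - 2))%R.
  move NE : (2 ^ k.+2) sl => N sl.
  have N4 : 3 < N by rewrite -NE !expnS; lia.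
  have DE : (2 ^+ k.+3 - 2 = N%:R * 2 - 2 :> rat)%R by rewrite exprSr -NE natrX.
  have D0 : (0 < N%:R * 2 - 2 :> rat)%R.
    have : (4%:R <= N%:R :> rat)%R by rewrite ler_nat.
    by lra.
  have x0 : (0 <= x)%R.
    have : (3%:R <= s%:R :> rat)%R by rewrite ler_nat.
    by move=> s3; rewrite /x DE divr_ge0 //; lra.
  (* With [N = 2 ^ t.-1] and [q > 2], [q] is the rounding of
     [(s - 2) / (2 * N - 2)] if and only if [2 * threshold q.-1 t.-1 < s <= 2 * threshold q t.-1]. *)
  have /andP[] := round_itv x0; set q := round x.
  rewrite /x DE ler_pdivlMr // ltr_pdivrMr // => lo up.
  have E1 : ((q%:R - 1 / 2) * (N%:R * 2 - 2) = q%:R * N%:R * 2 - q%:R * 2 - N%:R + 1 :> rat)%R.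
    by field.
  have E2 : ((q%:R + 1 / 2) * (N%:R * 2 - 2) = q%:R * N%:R * 2 - q%:R * 2 + N%:R - 1 :> rat)%R.
    by field.
  rewrite {}E1 in lo; rewrite {}E2 in up.
  have lo' : q * N * 2 + 3 <= s + N + q * 2.
    by rewrite -(ler_nat rat) !natrD !natrM; move: lo; lra.
  have up' : s + q * 2 < q * N * 2 + N + 1.
    by rewrite -(ltr_nat rat) !natrD !natrM; move: up; lra.
  have q3 : 2 < q.
    rewrite ltnNge; apply/negP => q2; move: sl up'.
    by case: (q) q2 => [|[|[|//]]] _; lia.
  apply: is_PR_threshold => //.
  + by lia.
  + by move: lo' q3 N4; clear; nia.
  + by right; lia.
  + rewrite -pred_Sn (thq q (ltnW q3)) NE mulnBl mul1n.
    by move: up' NE; rewrite expnS (mulnC q N); clear; lia.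
  + move=> q' qE _; rewrite -pred_Sn thq ?NE; last by lia.
    have : q' <= N * q' by rewrite leq_pmull //; lia.
    by rewrite mulnBl mul1n; move: lo' NE; rewrite qE expnS mulSn (mulnC q' N); clear; lia.
Qed.
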